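(* If $m\ge n\ge 1$ and $k\ge 3$, then: (i) $R(m\mathcal{C}_3^k,n\mathcal{C}_3^k)=m(3k-3)+2n-1$ and $R(m\mathcal{C}_4^k,n\mathcal{C}_3^k)=R(m\mathcal{C}_4^k,n\mathcal{C}_4^k)=m(4k-4)+2n-1$; (ii) $R(m\mathcal{P}_3^k,n\mathcal{C}_3^k)=m(3k-2)+2n-1$ and $R(m\mathcal{P}_4^k,n\mathcal{C}_3^k)=R(m\mathcal{P}_4^k,n\mathcal{C}_4^k)=m(4k-3)+2n-1$; (iii) $R(m\mathcal{P}_3^k,n\mathcal{P}_3^k)=m(3k-2)+2n-1$ and $R(m\mathcal{P}_4^k,n\mathcal{P}_3^k)=R(m\mathcal{P}_4^k,n\mathcal{P}_4^k)=m(4k-3)+2n-1$; (iv) $R(m\mathcal{S}_3^k,n\mathcal{S}_3^k)=m(3k-2)+n-1$; (v) for every $k$-uniform hypergraph $\mathcal{H}$, $R(m\mathcal{H},n\mathcal{K}_k^k)=m|V(\mathcal{H})|+n-1$; in particular $R(m\mathcal{K}_k^k,n\mathcal{K}_k^k)=mk+n-1$.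
   Context: A $k$-uniform hypergraph $\mathcal{H}$ is a pair $(V,E)$ where $V$ is a set of vertices and $E$ is a set of $k$-subsets of $V$ (the edges). $n\mathcal{H}$ denotes $n$ disjoint copies of $\mathcal{H}$. $\mathcal{K}_p^k$ is the complete $k$-uniform hypergraph on $p$ vertices; in particular $\mathcal{K}_k^k$ is a single edge. For $k$-uniform $\mathcal{G},\mathcal{H}$, the Ramsey number $R(\mathcal{G},\mathcal{H})$ is the smallest positive integer $N$ such that every red-blue coloring of the edges of $\mathcal{K}_N^k$ contains a red copy of $\mathcal{G}$ or a blue copy of $\mathcal{H}$. For a set of indexed vertices, adding $t$ means shifting all subscripts by $t$. Loose cycle $\mathcal{C}_n^k$: vertices $v_1,\dots,v_{n(k-1)}$, edges $e_i=\{v_1,\dots,v_k\}+i(k-1)$, $i=0,\dots,n-1$, subscripts mod $n(k-1)$. Loose path $\mathcal{P}_n^k$: vertices $v_1,\dots,v_{n(k-1)+1}$, edges $e_i=\{v_1,\dots,v_k\}+i(k-1)$, $i=0,\dots,n-1$. Star $\mathcal{S}_n^k$: vertices $v,v_1,\dots,v_{n(k-1)}$, edges $e_i=\{v\}\cup(\{v_1,\dots,v_{k-1}\}+i(k-1))$, $i=0,\dots,n-1$.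
   Formalization: In (v), H is assumed to have at least one vertex and, when n ≥ 2, no isolated vertices; without this the formula fails (e.g. H an edge plus an isolated vertex, m = n = 2, where the Ramsey number is at most 2k+2, not 2k+3). *)

(* Defs.v *)
From mathcomp Require Import all_boot.

Set Implicit Arguments.
Unset Strict Implicit.
Unset Printing Implicit Defensive.

Record hypergraph := Hypergraph {
  vertices :> finType;
  edges : {set {set vertices}}
}.

Definition uniform (k : nat) (H : hypergraph) : Prop :=
  forall e : {set H}, e \in edges H -> #|e| = k.

(* For [2 <= n <= m] the formula [m |V(H)| + n - 1] for the Ramsey number of
   [m] copies of [H] against [n] disjoint edges fails whenever [H] has an
   isolated vertex: isolated vertices of a red copy may be placed anywhere. *)
Definition no_isolated_vertex (H : hypergraph) : Prop :=
  forall v : H, exists2 e : {set H}, e \in edges H & v \in e.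

Definition complete (k p : nat) : hypergraph :=
  @Hypergraph 'I_p [set e : {set 'I_p} | #|e| == k].

Definition copies (n : nat) (H : hypergraph) : hypergraph :=
  @Hypergraph ('I_n * H)%type
    [set [set (i, x) | x in e] | i : 'I_n, e : {set H} in edges H].

(* In the next three definitions subscripts start at 0 instead of 1. *)

Definition loose_cycle (k n : nat) : hypergraph :=
  @Hypergraph 'I_(n * k.-1)
    [set [set v : 'I_(n * k.-1) |
            [exists j : 'I_k, v == (j + i * k.-1) %% (n * k.-1) :> nat]]
       | i : 'I_n].

Definition loose_path (k n : nat) : hypergraph :=
  @Hypergraph 'I_(n * k.-1).+1
    [set [set v : 'I_(n * k.-1).+1 |
            [exists j : 'I_k, v == j + i * k.-1 :> nat]]
       | i : 'I_n].

(* [None] is the centre of the star. *)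
Definition star (k n : nat) : hypergraph :=
  @Hypergraph (option 'I_(n * k.-1))
    [set None |: [set Some v | v in [set v : 'I_(n * k.-1) |
            [exists j : 'I_k.-1, v == j + i * k.-1 :> nat]]]
       | i : 'I_n].

(* [F] contains a copy of [G], not necessarily induced. *)
Definition contains_copy (G F : hypergraph) : Prop :=
  exists2 f : G -> F, injective f &
    forall e : {set G}, e \in edges G -> f @: e \in edges F.

(* A red-blue colouring is a boolean function, [true] being red; only its
   values on the edges of [complete k N] matter. *)
Definition color_class (k N : nat) (c : {set 'I_N} -> bool) (b : bool) :
    hypergraph :=
  @Hypergraph 'I_N [set e in edges (complete k N) | c e == b].

Definition arrows (k N : nat) (G H : hypergraph) : Prop :=
  forall c : {set 'I_N} -> bool,
    contains_copy G (color_class k c true) \/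
    contains_copy H (color_class k c false).

(* The graph of the partial function [(G, H) |-> R(G, H)]: stating it as a
   relation includes the existence of the minimum. *)
Definition is_ramsey_number (k : nat) (G H : hypergraph) (N : nat) : Prop :=
  [/\ 0 < N,
      arrows k N G H
    & forall M : nat, 0 < M -> arrows k M G H -> N <= M].

(* Main.v *)
Require Import Defs.
From mathcomp Require Import all_boot zify.
From Stdlib Require Import Classical.

(** Lower bounds: colour red the edges inside a set of [m |G| - 1] vertices;
    each blue copy of [H] then uses at least [t] of the other [t n - 1]
    vertices, where [t] is the vertex cover number of [H].

    Upper bounds reduce to [m = n = 1].  If every set of [|G| + t - 1] vertices
    contains a red [G] or a blue [H], exchanging vertices one at a time leads
    to a set of at most [|G| + t] vertices containing both, and removing it
    lowers [m] and [n] by one.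

    The cases [m = n = 1] rest on paths of two edges with given ends [x], [y]
    and interior [Y].  If [Y] carries neither a red nor a blue such path, an
    exchange argument shows that all edges made of [x] and vertices of [Y] have
    one colour, and those made of [y] and vertices of [Y] the other.  For
    triangles such [x], [y] are found in the common part of a red and a blue
    edge that differ by one vertex.  For quadrangles, the sets carrying a path
    of a given colour would otherwise 2-colour a non-bipartite Kneser graph, so
    such [x], [y], [Y] exist; this forces a set [L] of [2k - 2] vertices such
    that all edges meeting both [L] and its complement have the same colour.
    For stars one fixes [k - 2] vertices and compares the pairs of remaining
    vertices they complete to edges with the partitions of the remaining
    [2k] vertices into two edges. Paths, and the pair of a quadrangle and a
    triangle, follow by rerouting a monochromatic cycle through the
    remaining vertices. *)

Set Implicit Arguments.
Unset Strict Implicit.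
Unset Printing Implicit Defensive.

(** * Sequences without repetition *)

Section Counting.

Variable T : finType.
Implicit Types (s t : seq T) (x y z : T).

(** Inclusion of multisets: for a duplicate-free [t] it says at once that [s] is duplicate-free and
    contained in [t]. Stated pointwise, it is a linear inequality that [counting] can use. *)
Definition within s t := forall z, count_mem z s <= count_mem z t.

Lemma count_uniq s : uniq s -> forall z, count_mem z s <= 1.
Proof. by move=> us z; rewrite count_uniq_mem //; case: (_ \in _). Qed.

Lemma uniq_count s : (forall z, count_mem z s <= 1) -> uniq s.
Proof.
move=> h; apply: count_mem_uniq => z; have := h z.
by have := has_pred1 z s; rewrite has_count; case: (z \in s) => /=; lia.
Qed.

Lemma count_perm s t : perm_eq s t -> forall z, count_mem z s = count_mem z t.
Proof. by move=> /permP h z; apply: h. Qed.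

Lemma perm_count s t : (forall z, count_mem z s = count_mem z t) -> perm_eq s t.
Proof. by move=> h; rewrite /perm_eq; apply/allP => z _ /=; rewrite h. Qed.

Lemma count_neq x y : x != y -> forall z, count_mem z [:: x; y] <= 1.
Proof. by move=> ne; apply: count_uniq; rewrite /= inE ne. Qed.

Lemma count_mem1 x s : x \in s -> forall z, count_mem z [:: x] <= count_mem z s.
Proof.
move=> xs z; rewrite /= addn0; case: eqP => // <-.
by rewrite -has_count has_pred1.
Qed.

Lemma within_uniq s t : uniq s -> {subset s <= t} -> within s t.
Proof. by move=> us st z; apply: leq_uniq_count. Qed.

Lemma within_mem s t : within s t -> {subset s <= t}.
Proof.
by move=> h z; rewrite -!has_pred1 !has_count => zs; apply: leq_trans (h z).
Qed.

Lemma mem_perm_cons x s : x \in s -> exists r, perm_eq s (x :: r).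
Proof. by move=> xs; exists (rem x s); apply: perm_to_rem. Qed.

Lemma split_at n s : n <= size s ->
  exists s1 s2, [/\ s = s1 ++ s2, size s1 = n & size s2 = size s - n].
Proof.
move=> h; exists (take n s), (drop n s).
by rewrite cat_take_drop size_takel // size_drop.
Qed.

Lemma within_rest s t : within s t -> exists r, perm_eq t (s ++ r).
Proof.
elim: s t => [|x s IH] t h; first by exists t.
have xt : x \in t by apply: within_mem h _ _; rewrite inE eqxx.
have [t' tt'] := mem_perm_cons xt.
have [r hr] : exists r, perm_eq t' (s ++ r).
  by apply: IH => z; have := h z; rewrite (count_perm tt') /=; lia.
by exists r; apply: perm_trans tt' _; rewrite /= perm_cons.
Qed.

Lemma uniq_rest s : uniq s ->
  exists r, uniq (s ++ r) /\ size s + size r = #|T|.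
Proof.
move=> us; have [|r hr] := @within_rest s (enum T).
  by apply: within_uniq => // z _; rewrite mem_enum.
exists r; rewrite -(perm_uniq hr) enum_uniq; split => //.
by rewrite cardE (perm_size hr) size_cat.
Qed.

End Counting.

(* Goals about [uniq], [perm_eq] and [within] on concatenations are linear in
   the multiplicities of each element. *)
Ltac lin :=
  rewrite /= ?count_cat ?size_cat /= ?count_cat ?size_cat /= ?count_cat ?size_cat /=;
  repeat match goal with
  | |- context [nat_of_bool ?b] => generalize (nat_of_bool b); intro
  | |- context [@count ?U ?p ?s] => generalize (@count U p s); intro
  end;
  clear; lia.

Ltac counting :=
  match goal with
  | |- is_true (uniq _) => apply: uniq_count
  | |- is_true (perm_eq _ _) => apply: perm_count
  | |- within _ _ => idtac
  end;
  let z := fresh "z" in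
  move=> z;
  repeat match goal with
  | H : is_true (uniq _) |- _ => generalize (count_uniq H z); clear H
  | H : is_true (perm_eq _ _) |- _ => generalize (count_perm H z); clear H
  | H : is_true (_ \in _) |- _ => generalize (count_mem1 H z); clear H
  | H : is_true (_ != _) |- _ => generalize (count_neq H z); clear H
  | H : within _ _ |- _ => generalize (H z); clear H
  end;
  lin.

(** Besides goals on lengths, this closes the branches in which a sequence is too short, since their
    length equations are inconsistent. *)
Ltac sizing :=
  repeat match goal with
  | H : is_true (perm_eq _ _) |- _ => generalize (perm_size H); clear H
  | H : @eq nat _ _ |- _ => revert H
  | H : is_true (_ <= _) |- _ => revert H
  end;
  rewrite /= ?size_cat /= ?size_cat /= ?size_cat /=;
  repeat match goal with
  | |- context [@size ?U ?s] => generalize (@size U s); intro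
  | |- context [@card ?U ?s] => generalize (@card U s); intro
  end;
  clear; lia.

(** * Exchanging single elements between sets of equal size *)

Section Johnson.

Variable T : finType.
Implicit Types (A D Y : seq T).

(** Connectedness of the Johnson graph: replacing an element of [D] outside [D'] by one of [D']
    outside [D] brings [D] closer to [D']. *)
Lemma johnson (Q : seq T -> Prop) Y r :
    uniq Y ->
    (forall A D, perm_eq A D -> Q A -> Q D) ->
    (forall w w' A, within (w :: w' :: A) Y -> size A = r ->
       Q (w :: A) -> Q (w' :: A)) ->
  forall D D', within D Y -> within D' Y -> size D = r.+1 -> size D' = r.+1 ->
    Q D -> Q D'.
Proof.
move=> uY Qperm Qswap D D' DY D'Y sD sD'.
have [n] := ubnP (count [predC D'] D); elim: n D DY sD => // n IH D DY sD le QD.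
have uD : uniq D by counting.
have uD' : uniq D' by counting.
have [/hasP[w wD /= wD'] | nD] := boolP (has [predC D'] D); last first.
  apply: Qperm QD; apply: uniq_perm => //.
  have DD' : {subset D <= D'}.
    by move=> z zD; apply: contraNT nD => zD'; apply/hasP; exists z.
  by apply: (uniq_min_size uD DD' _).2; rewrite sD sD'.
have [A pA] := mem_perm_cons wD.
have /hasP[w' w'D' /= w'D] : has [predC D] D'.
  apply: contraT => nD'; case/negP: wD'.
  have D'D : {subset D' <= D}.
    by move=> z zD'; apply: contraNT nD' => zD; apply/hasP; exists z.
  by rewrite (uniq_min_size uD' D'D _).2 ?sD ?sD'.
have ww' : within [:: w'] Y by apply: within_uniq => // z; rewrite inE => /eqP->;
  apply: within_mem D'Y _ _.
have w'A : within (w :: w' :: A) Y.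
  have uw'D : uniq (w' :: D) by rewrite /= w'D.
  clear -uw'D ww' DY pA; counting.
apply: (IH (w' :: A)).
- by counting.
- by sizing.
- by move: le; rewrite (permP pA) /= w'D' wD'; rewrite add1n add0n ltnS.
- apply: Qswap w'A _ _; first by sizing.
  by apply: Qperm QD.
Qed.

End Johnson.

(** * Paths of two edges *)

Section Coloring.

Variables (T : finType) (r : nat) (c : {set T} -> bool).
Hypothesis r_gt0 : 0 < r.
Implicit Types (A B C D Y : seq T) (b : bool).

Definition col (s : seq T) := c [set x in s].

Lemma col_perm A B : perm_eq A B -> col A = col B.
Proof.
by move=> pAB; congr c; apply/setP => z; rewrite !inE (perm_mem pAB).
Qed.

(** For distinct [x], [y] outside a duplicate-free [Y] this is a loose path of two edges with middle
    vertex [w]. Edges have [r.+2] vertices, so [r] is [k - 2], and the path takes [2 * r + 1]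
    vertices of [Y]. *)
Definition conn b Y x y := exists w A B,
  [/\ within (w :: A ++ B) Y, size A = r, size B = r,
      col (x :: w :: A) = b & col (y :: w :: B) = b].

Definition const_on b Y x :=
  forall D, within D Y -> size D = r.+1 -> col (x :: D) = b.

Definition cycle3 b := exists x y z A B C,
  uniq (x :: y :: z :: A ++ B ++ C) /\
  [/\ size A = r, size B = r & size C = r] /\
  [/\ col (x :: y :: A) = b, col (y :: z :: B) = b & col (z :: x :: C) = b].

Definition cycle4 b := exists x y z t A B C D,
  uniq (x :: y :: z :: t :: A ++ B ++ C ++ D) /\
  [/\ size A = r, size B = r, size C = r & size D = r] /\
  [/\ col (x :: y :: A) = b, col (y :: z :: B) = b,
      col (z :: t :: C) = b & col (t :: x :: D) = b].

Definition path3 b := exists x y A B C,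
  uniq (x :: y :: A ++ B ++ C) /\
  [/\ size A = r.+1, size B = r & size C = r.+1] /\
  [/\ col (x :: A) = b, col (x :: y :: B) = b & col (y :: C) = b].

Definition path4 b := exists x y z A B C D,
  uniq (x :: y :: z :: A ++ B ++ C ++ D) /\
  [/\ size A = r.+1, size B = r, size C = r & size D = r.+1] /\
  [/\ col (x :: A) = b, col (x :: y :: B) = b, col (y :: z :: C) = b
    & col (z :: D) = b].

Definition star3 b := exists x A B C,
  uniq (x :: A ++ B ++ C) /\
  [/\ size A = r.+1, size B = r.+1 & size C = r.+1] /\
  [/\ col (x :: A) = b, col (x :: B) = b & col (x :: C) = b].

Lemma conn_sym b Y x y : conn b Y x y -> conn b Y y x.
Proof.
by move=> [w [A [B [h1 h2 h3 h4 h5]]]]; exists w, B, A; split => //; counting.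
Qed.

Lemma conn_within b Y Y' x y : within Y Y' -> conn b Y x y -> conn b Y' x y.
Proof.
move=> YY' [w [A [B [h1 h2 h3 h4 h5]]]]; exists w, A, B; split => //.
by move=> z; apply: leq_trans (YY' z).
Qed.

(** An edge at [y] through both [w] and [w'] that avoids [A] is opposite in colour to [x :: w :: A]
    and to [x :: w' :: A]. Exchanging one vertex therefore preserves the colour, and [johnson]
    applies. *)
Lemma const_on_swap Y x y :
    uniq (x :: y :: Y) -> 2 * r + 1 <= size Y ->
    (forall w A B, within (w :: A ++ B) Y -> size A = r -> size B = r ->
       col (x :: w :: A) = ~~ col (y :: w :: B)) ->
  forall D D', within D Y -> within D' Y -> size D = r.+1 -> size D' = r.+1 ->
    col (x :: D) = col (x :: D').
Proof.
move=> uY sY key D D' DY D'Y sD sD'.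
apply: (@johnson _ (fun D' => col (x :: D) = col (x :: D')) Y r _ _ _ D D') => //.
- by counting.
- by move=> A B pAB ->; apply: col_perm; counting.
move=> w w' A wA sA ->.
have [R pR] := within_rest wA.
have [|B [R' [defR sB _]]] := @split_at _ r.-1 R; first by sizing.
rewrite {R}defR in pR.
rewrite (key w A (w' :: B)) //; try by [sizing | counting].
rewrite (key w' A (w :: B)) //; try by [sizing | counting].
by congr (~~ _); apply: col_perm; counting.
Qed.

(** Without paths, an edge at [x] and an edge at [y] sharing one vertex of [Y] have opposite
    colours; [const_on_swap] then applies at both ends. *)
Lemma not_conn_const_on_opposite Y x y :
    uniq (x :: y :: Y) -> 2 * r + 1 <= size Y ->
    (forall b, ~ conn b Y x y) ->
  exists b, const_on b Y x /\ const_on (~~ b) Y y.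
Proof.
move=> uY sY nconn.
have key w A B : within (w :: A ++ B) Y -> size A = r -> size B = r ->
    col (x :: w :: A) = ~~ col (y :: w :: B).
  move=> h sA sB; case e: (col (x :: _)); case e': (col (y :: _)) => //.
    by case: (nconn true); exists w, A, B.
  by case: (nconn false); exists w, A, B.
have key' w A B : within (w :: A ++ B) Y -> size A = r -> size B = r ->
    col (y :: w :: A) = ~~ col (x :: w :: B).
  by move=> h sA sB; rewrite (key w B A) ?negbK //; counting.
have [|[|w A] [R [defY sA sR]]] := @split_at _ r.+1 Y; [by sizing|by []|].
have [|B [R' [defR sB _]]] := @split_at _ r R; first by sizing.
case: sA => sA; exists (col (x :: w :: A)); split => D DY sD.
- by apply: (const_on_swap uY sY key) => //; [rewrite defY; counting | sizing].
- rewrite (key w A B) ?negbK //; last by rewrite defY defR; counting.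
  apply: (@const_on_swap Y y x) => //; last 2 first.
  + by rewrite defY defR; counting.
  + by sizing.
  + by counting.
Qed.

Lemma conn_cycle4 b Y Y' x y :
  uniq (x :: y :: Y ++ Y') -> conn b Y x y -> conn b Y' x y -> cycle4 b.
Proof.
move=> u [w [A [B [h1 h2 h3 h4 h5]]]] [w' [A' [B' [g1 g2 g3 g4 g5]]]].
exists x, w, y, w', A, B, B', A'; split; first by counting.
split; first by split.
split => //.
- by rewrite -h5; apply: col_perm; counting.
- by rewrite -g4; apply: col_perm; counting.
Qed.

Lemma const_on_conn b Y x y : 2 * r + 1 <= size Y ->
  const_on b Y x -> const_on b Y y -> conn b Y x y.
Proof.
move=> sY cx cy.
have [|[|w A] [R [defY sA sR]]] := @split_at _ r.+1 Y; [by sizing|by []|].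
have [|B [R' [defR sB _]]] := @split_at _ r R; first by sizing.
rewrite defR in defY; case: sA => sA.
exists w, A, B; split => //; first by rewrite defY; counting.
- by apply: cx; [rewrite defY; counting | sizing].
- by apply: cy; [rewrite defY; counting | sizing].
Qed.

Lemma const_on_inj b b' Y x : r < size Y ->
  const_on b Y x -> const_on b' Y x -> b = b'.
Proof.
move=> sY; have [|D [R [defY sD _]]] := @split_at _ r.+1 Y; first by sizing.
by move=> h h'; rewrite -(h D) ?(h' D) //; rewrite defY; counting.
Qed.

(** Otherwise exchanging one vertex never changes the colour of an edge, and by [johnson] all edges
    have the same colour. *)
Lemma not_constant :
  (forall b, ~ (forall D, uniq D -> size D = r.+2 -> col D = b)) ->
  exists b x y A, [/\ uniq (x :: y :: A), size A = r.+1,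
    col (x :: A) = b & col (y :: A) = ~~ b].
Proof.
move=> nc; apply: NNPP => nex.
have h D D' : uniq D -> uniq D' -> size D = r.+2 -> size D' = r.+2 ->
    col D = col D'.
  move=> uD uD' sD sD'.
  have inT A : uniq A -> within A (enum T).
    by move=> uA; apply: within_uniq => // z _; rewrite mem_enum.
  apply: (@johnson _ (fun D' => col D = col D') (enum T) r.+1 _ _ _ D D');
    rewrite ?enum_uniq //; try exact: inT.
  - by move=> A B pAB ->; apply: col_perm.
  move=> w w' A wA sA ->; apply/eqP; apply: contraT => e.
  case: nex; exists (col (w :: A)), w, w', A; split => //.
    by have uT := enum_uniq T; counting.
  by move: e; case: (col _); case: (col _).
have [[D [uD sD]] | nD] := classic (exists D, uniq D /\ size D = r.+2).
  by apply: (nc (col D)) => D' uD' sD'; apply: h.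
by apply: (nc true) => D uD sD; case: nD; exists D.
Qed.

End Coloring.

(** * Triangles *)

Ltac recolor H := rewrite -H; apply: col_perm; counting.

Section Triangle.

Variables (T : finType) (r : nat) (c : {set T} -> bool).
Hypothesis r_gt0 : 0 < r.
Implicit Types (A B D Y Z : seq T) (b : bool).
Local Notation col := (col c).
Local Notation conn := (conn r c).
Local Notation const_on := (const_on r c).

Lemma conn_cycle3 b Y Z x y : uniq (x :: y :: Y ++ Z) -> size Z = r ->
  col (x :: y :: Z) = b -> conn b Y x y -> cycle3 r c b.
Proof.
move=> u sZ eZ [w [A [B [h1 h2 h3 h4 h5]]]].
exists x, w, y, A, B, Z; split; first by counting.
split=> //; split=> //; first by recolor h5.
by recolor eZ.
Qed.

(** An edge of colour [b] at [x] could be continued, from any of its vertices in [Y], by a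
    disjointly chosen edge to [y], giving a path. *)
Lemma not_conn_const_on b Y x y : 2 * r + 1 <= size Y -> uniq Y ->
  const_on b Y y -> ~ conn b Y x y -> const_on (~~ b) Y x.
Proof.
move=> sY uY cy ny D DY sD; case: D DY sD => // w A wA [sA].
have [e | ne] := eqVneq (col (x :: w :: A)) b; last first.
  by move: ne; case: (col _); case: (b).
have [R pR] := within_rest wA.
have [|B [R' [defR sB _]]] := @split_at _ r R; first by sizing.
rewrite defR in pR; case: ny; exists w, A, B; split => //; first by counting.
by apply: cy; [counting | sizing].
Qed.

(** If there is no triangle, the edge [x :: u :: v :: S] forbids paths of colour [b] from [x] to [u]
    in [Y], and [y :: u :: v :: S] forbids paths of colour [~~ b] from [y] to [v]. So [x] and [y]
    are constant on [Y], of colours [~~ b] and [b]. *)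
Lemma cycle3_of_opposite b x y u v S Y :
    uniq (x :: y :: u :: v :: S ++ Y) -> size S = r.-1 -> 2 * r + 1 <= size Y ->
    col (x :: u :: v :: S) = b -> col (y :: u :: v :: S) = ~~ b ->
    const_on b Y u -> const_on (~~ b) Y v ->
  exists b', cycle3 r c b'.
Proof.
move=> uniV sS sY ex ey cu cv; apply: NNPP => nc.
have uY : uniq Y by counting.
have cx : const_on (~~ b) Y x.
  apply: not_conn_const_on cu _ => // h; apply: nc; exists b.
  by apply: (@conn_cycle3 b Y (v :: S) x u) h => //; [counting | sizing].
have cy : const_on b Y y.
  rewrite -[b]negbK; apply: not_conn_const_on cv _ => // h.
  apply: nc; exists (~~ b).
  apply: (@conn_cycle3 _ Y (u :: S) y v) h => //; [counting | sizing |].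
  by recolor ey.
have [|[|w [|o A]] [R [defY sA sR]]] := @split_at _ r.+1 Y;
  [by sizing | by sizing | by sizing |].
have [|B [R' [defR sB _]]] := @split_at _ r R; first by sizing.
(* Whatever its colour, this edge is a side of a triangle: the other two sides contain [y] and [u]
   if the colour is [b], and [x] and [v] otherwise. *)
case eg: (col (o :: u :: v :: S) == b).
  apply: nc; exists b, o, w, u, (y :: A), B, (v :: S).
  rewrite defR in defY; split; first by move: uniV; rewrite defY => uniV; counting.
  split; first by split; sizing.
  split; last by rewrite -(eqP eg); apply: col_perm; counting.
    rewrite -(cy (o :: w :: A)); try (by sizing); last by rewrite defY; counting.
    by apply: col_perm; counting.
  rewrite -(cu (w :: B)); try (by sizing); last by rewrite defY; counting.
  by apply: col_perm; counting.
apply: nc; exists (~~ b), o, w, v, (x :: A), B, (u :: S).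
rewrite defR in defY; split; first by move: uniV; rewrite defY => uniV; counting.
split; first by split; sizing.
split.
- rewrite -(cx (o :: w :: A)); try (by sizing); last by rewrite defY; counting.
  by apply: col_perm; counting.
- rewrite -(cv (w :: B)); try (by sizing); last by rewrite defY; counting.
  by apply: col_perm; counting.
- transitivity (col (o :: u :: v :: S)); first by apply: col_perm; counting.
  by move: eg; case: (col _); case: (b).
Qed.

Lemma cycle3_exists : 3 * r + 4 <= #|T| -> exists b, cycle3 r c b.
Proof.
move=> sT; apply: NNPP => nc.
have [b [x [y [S [uS sS ex ey]]]]] : exists b x y A, [/\ uniq (x :: y :: A),
    size A = r.+1, col (x :: A) = b & col (y :: A) = ~~ b].
  apply: not_constant => b hb; apply: nc; exists b.
  have [|[|x [|y [|z W]]] [W' [defT sW _]]] := @split_at _ (3 * r + 3) (enum T);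
    rewrite -?cardE; try (by sizing); try (by move: sW; sizing).
  have uW : uniq (enum T) by apply: enum_uniq.
  rewrite defT in uW.
  have [|A [BC [defW sA sBC]]] := @split_at _ r W; first by sizing.
  have [|B [C [defBC sB sC]]] := @split_at _ r BC; first by sizing.
  rewrite defW defBC in uW.
  exists x, y, z, A, B, C; split; first by counting.
  split; first by split; sizing.
  by split; apply: hb; (counting || sizing).
have [W [uW sW]] := uniq_rest uS.
case: S sS uS ex ey uW sW => [|u [|v S]] sS uS ex ey uW sW; try by sizing.
(* The two edges together have [r + 3] vertices, which leaves exactly enough for a path. *)
have sV : 2 * r + 1 <= size W by sizing.
(* Both edges contain [u] and [v], so the one of colour [b'] would close the path to a triangle. *)
have nconn b' : ~ conn b' W u v.
  move=> h; apply: nc; exists b'.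
  have [e | ne] := eqVneq b' b.
    apply: (@conn_cycle3 b' W (x :: S) u v) h; try by (counting || sizing).
    by rewrite e; recolor ex.
  apply: (@conn_cycle3 b' W (y :: S) u v) h; try by (counting || sizing).
  have -> : b' = ~~ b by move: ne; case: (b'); case: (b).
  by recolor ey.
have uvW : uniq (u :: v :: W) by counting.
have [a [cu cv]] := not_conn_const_on_opposite r_gt0 uvW sV nconn.
apply: nc; have [e | ne] := eqVneq a b.
  apply: (@cycle3_of_opposite b x y u v S W) => //; try by (counting || sizing).
  - by rewrite -e.
  - by rewrite -e.
have e : a = ~~ b by move: ne; case: (a); case: (b).
apply: (@cycle3_of_opposite b x y v u S W) => //; try by (counting || sizing).
- by recolor ex.
- by recolor ey.
- by rewrite -[b]negbK -e.
- by rewrite -e.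
Qed.

End Triangle.

(** * Quadrangles *)

Lemma within_cons (T : finType) (t : T) (D Y : seq T) : uniq D -> within D (t :: Y) ->
  within D Y \/ exists2 Q, perm_eq D (t :: Q) & within Q Y.
Proof.
move=> uD DtY; have [tD | tD] := boolP (t \in D).
  have [Q pQ] := mem_perm_cons tD; right; exists Q => //.
  by move=> z; have := DtY z; rewrite (count_perm pQ) /= leq_add2l.
left; apply: within_uniq => // z zD.
have : z \in t :: Y by apply: within_mem DtY _ _.
by rewrite inE => /orP[/eqP e | //]; rewrite -e zD in tD.
Qed.

Section Quadrangle.

Variables (T : finType) (r : nat) (c : {set T} -> bool) (V : seq T).
Hypothesis r_gt0 : 0 < r.
Hypothesis uV : uniq V.
Hypothesis sV : size V = 4 * r + 5.
Hypothesis no_cycle4 : forall b, ~ cycle4 r c b.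
Implicit Types (A B D Y Z : seq T) (b : bool).
Local Notation col := (col c).
Local Notation conn := (conn r c).
Local Notation const_on := (const_on r c).

Lemma not_conn_disjoint b Y Z x y :
  within (x :: y :: Y ++ Z) V -> conn b Y x y -> ~ conn b Z x y.
Proof.
by move=> h cY cZ; apply: (no_cycle4 (b := b)); apply: conn_cycle4 cY cZ; counting.
Qed.

(** The middle vertex of the path is [x]. *)
Lemma const_pair_conn b Y S x d e : const_on b Y x ->
  within (d :: e :: S) Y -> size S = 2 * r -> conn b (x :: S) d e.
Proof.
move=> cx h sS; have [|A [B [defS sA sB]]] := @split_at _ r S; first by sizing.
rewrite {}defS in h *.
exists x, A, B; split => //; first by sizing.
- rewrite -(cx (d :: A)); [|by counting|by sizing].
  by apply: col_perm; counting.
- rewrite -(cx (e :: B)); [|by counting|by sizing].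
  by apply: col_perm; counting.
Qed.

(** Inside [x :: y :: Y] the vertices [d], [e] are joined through [x] in colour [b] and through [y]
    in colour [~~ b]; a path in [X] would complete one of these to a quadrangle. *)
Lemma opposite_not_conn b Y X x y d e S b' :
  within (x :: y :: Y ++ X) V -> const_on b Y x -> const_on (~~ b) Y y ->
  perm_eq Y (d :: e :: S) -> size S = 2 * r -> ~ conn b' X d e.
Proof.
move=> h cx cy pY sS.
have [-> | ne] := eqVneq b' b.
  apply: (@not_conn_disjoint _ (x :: S)); first by counting.
  by apply: const_pair_conn cx _ _ => //; counting.
have -> : b' = ~~ b by move: ne; case: b'; case: b {cx cy}.
apply: (@not_conn_disjoint _ (y :: S)); first by counting.
by apply: const_pair_conn cy _ _ => //; counting.
Qed.

(* Any two vertices of [Y] would be joined by paths of both colours through [x]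
   and [y], so they have opposite constant colours on the remaining vertices:
   impossible for three of them. *)
Lemma no_opposite b Y x y : within (x :: y :: Y) V -> size Y = 2 * r + 2 ->
  const_on b Y x -> const_on (~~ b) Y y -> False.
Proof.
move=> hV sY cx cy; have [X pV] := within_rest hV.
have sX : 2 * r + 1 <= size X by sizing.
have opp d e S : perm_eq Y (d :: e :: S) ->
    exists b', const_on b' X d /\ const_on (~~ b') X e.
  move=> pY; have sS : size S = 2 * r by sizing.
  have hX : within (x :: y :: Y ++ X) V by counting.
  apply: not_conn_const_on_opposite => // [|b']; first by counting.
  exact: (opposite_not_conn hX cx cy pY sS).
case: Y sY hV cx cy pV opp => [|d1 [|d2 [|d3 Y]]] sY hV cx cy pV opp; try by sizing.
have [|a [c1 c2]] := opp d1 d2 (d3 :: Y); first by counting.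
have [|a' [c1' c3]] := opp d1 d3 (d2 :: Y); first by counting.
have [|a'' [c2' c3']] := opp d2 d3 (d1 :: Y); first by counting.
have lX : r < size X by sizing.
have e1 := const_on_inj r_gt0 lX c1 c1'; have e2 := const_on_inj r_gt0 lX c2 c2'.
have e3 := const_on_inj r_gt0 lX c3 c3'.
by move: e1 e2 e3; case: (a); case: (a'); case: (a'').
Qed.

Lemma conn_total Y x y : within (x :: y :: Y) V -> size Y = 2 * r + 2 ->
  exists b, conn b Y x y.
Proof.
move=> hV sY; apply: NNPP => nc.
have [||b|b [cx cy]] := @not_conn_const_on_opposite _ _ c r_gt0 Y x y;
  try by (counting || sizing).
  by move=> cb; apply: nc; exists b.
exact: no_opposite hV sY cx cy.
Qed.

(* If all five blue paths existed (blue being [~~ b]), then [a, a'] would have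
   one constant colour on the vertices left over and [d, d'] the other; the
   colour [~~ b] is excluded for both pairs by the first two paths. *)
Lemma no_path2 b x s a a' A d d' D :
    within (x :: s :: a :: a' :: A ++ d :: d' :: D) V ->
    size A = r.-1 -> size D = r.-1 ->
    col (x :: a :: a' :: A) = b -> col (x :: d :: d' :: D) = b ->
    conn (~~ b) (x :: s :: d :: d' :: A ++ D) a a' ->
    conn (~~ b) (x :: s :: a :: a' :: A ++ D) d d' ->
    conn (~~ b) (x :: s :: a' :: d' :: A ++ D) a d ->
    conn (~~ b) (x :: s :: a' :: d :: A ++ D) a d' ->
    conn (~~ b) (x :: s :: a :: d' :: A ++ D) a' d -> False.
Proof.
move=> hV sA sD ea ed caa cdd cad cad' ca'd; have [X pV] := within_rest hV.
have sX : 2 * r + 1 <= size X by sizing.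
have opp p q Y : perm_eq (p :: q :: Y) (x :: s :: a :: a' :: A ++ d :: d' :: D) ->
    conn b Y p q -> conn (~~ b) Y p q ->
    exists b', const_on b' X p /\ const_on (~~ b') X q.
  move=> pY cb cnb; apply: not_conn_const_on_opposite => // [|b']; first by counting.
  have [-> | ne] := eqVneq b' b.
    by apply: not_conn_disjoint cb; counting.
  have -> : b' = ~~ b by move: ne; case: b'; case: b {ea ed caa cdd cad cad' ca'd cb cnb}.
  by apply: not_conn_disjoint cnb; counting.
have [||e [c1 c2]] := opp a d _ _ _ cad; first by counting.
  exists x, (a' :: A), (d' :: D); split; by [counting | sizing | recolor ea | recolor ed].
have [||e' [c1' c3]] := opp a d' _ _ _ cad'; first by counting.
  exists x, (a' :: A), (d :: D); split; by [counting | sizing | recolor ea | recolor ed].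
have [||e'' [c4 c2']] := opp a' d _ _ _ ca'd; first by counting.
  exists x, (a :: A), (d' :: D); split; by [counting | sizing | recolor ea | recolor ed].
have lX : r < size X by sizing.
have h1 := const_on_inj r_gt0 lX c1 c1'; have h2 := const_on_inj r_gt0 lX c2 c2'.
have h3 : e = b.
  have [//|ne] := eqVneq e b.
  have eb : e = ~~ b by move: ne; case: (e); case: (b).
  have eb' : e'' = ~~ b by move: h2; rewrite eb; case: (e''); case: (b).
  rewrite eb in c1; rewrite eb' in c4.
  case: (not_conn_disjoint (Z := X) _ caa); first by counting.
  exact: const_on_conn.
case: (not_conn_disjoint (Z := X) _ cdd); first by counting.
by apply: const_on_conn => //; rewrite -h3 // h1.
Qed.

(* Otherwise each [2 r + 1] of the vertices other than [x] and [y] carry a path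
   of exactly one colour, and disjoint sets carry opposite colours, so that
   replacing one vertex preserves the colour. *)
Lemma exists_opposite : exists b x y Y,
  [/\ within (x :: y :: Y) V, size Y = 2 * r + 1, const_on b Y x
    & const_on (~~ b) Y y].
Proof.
apply: NNPP => nopp.
(* The remaining [W] has [4 * r + 3] vertices, one more than two disjoint sets of [2 * r + 1]: the
   Kneser graph in question is an odd graph. *)
have [|[|x [|y xy]] [W [defV sxy sW]]] := @split_at _ 2 V;
  [by sizing | by [] | by [] |].
case: xy sxy defV => // _ defV.
have some_conn Y : within Y W -> size Y = 2 * r + 1 -> exists b, conn b Y x y.
  move=> YW sY; apply: NNPP => nc.
  have [|||b [cx cy]] := @not_conn_const_on_opposite _ _ c r_gt0 Y x y.
  - by move: uV; rewrite defV => uV'; counting.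
  - by sizing.
  - by move=> b cb; apply: nc; exists b.
  by apply: nopp; exists b, x, y, Y; split => //; rewrite defV; counting.
have disj b Y Z : within (Y ++ Z) W -> conn b Y x y -> ~ conn b Z x y.
  by move=> h; apply: not_conn_disjoint; rewrite defV; counting.
have flip b Y Z : within (Y ++ Z) W -> size Z = 2 * r + 1 -> conn b Y x y ->
    conn (~~ b) Z x y.
  move=> h sZ cb; have ZW : within Z W by counting.
  have [b' cb'] := some_conn Z ZW sZ.
  have [e | ne] := eqVneq b' b.
    by case: (disj b Y Z h cb); rewrite -e.
  by have <- : b' = ~~ b by move: ne; case: (b'); case: (b).
have uW : uniq W by move: uV; rewrite defV => uV'; counting.
(* The sets [w :: A] and [w' :: A] have a common disjoint set [R] of [2 * r + 1] vertices, so [flip]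
   is applied twice through [R]. *)
have same b Y Y' : within Y W -> within Y' W -> size Y = 2 * r + 1 ->
    size Y' = 2 * r + 1 -> conn b Y x y -> conn b Y' x y.
  move=> YW Y'W sY sY'.
  apply: (@johnson _ (fun Y => conn b Y x y) W (2 * r)) => //; try by sizing.
    by move=> A D pAD; apply: conn_within; counting.
  move=> w w' A wA sA cA; have [R pR] := within_rest wA.
  rewrite -[b]negbK; apply: (@flip _ R); [by counting | by sizing |].
  by apply: flip cA; [counting | sizing].
have [|Y [Z' [defW sY sZ']]] := @split_at _ (2 * r + 1) W; first by sizing.
have [|Z [Z'' [defZ sZ _]]] := @split_at _ (2 * r + 1) Z'; first by sizing.
have YZ : within (Y ++ Z) W by rewrite defW defZ; counting.
have YW : within Y W by counting.
have [b cb] := some_conn Y YW sY.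
have ZW : within Z W by counting.
exact: (disj b Y Z YZ cb (same b Y Z YW ZW sY sZ cb)).
Qed.

(** * The colour of the edges that meet both [x :: Y] and [y :: M] *)

Section Extremal.

Variables (b : bool) (x y : T) (Y M : seq T).
Hypothesis pV : perm_eq V (y :: x :: Y ++ M).
Hypothesis sY : size Y = 2 * r + 1.
Hypothesis cx : const_on b Y x.
Hypothesis cy : const_on (~~ b) (x :: Y) y.

Lemma conn_through_y p q S :
  perm_eq (x :: Y) (p :: q :: S) -> conn (~~ b) (y :: S) p q.
Proof.
move=> pS; have uV' := uV.
by apply: const_pair_conn cy _ _; [counting | sizing].
Qed.

(** Each vertex of [F] is joined to each vertex of [G] through [e] in colour [b] and through [y] in
    colour [~~ b], so they get opposite constant colours on [Z]. Were that of [F] equal to [~~ b],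
    two of its vertices would be joined in this colour both in [Z] and through [y]. Finally [u] is
    joined to [F] through [e] in colour [b]. *)
Lemma sides u Z e F G : perm_eq M (u :: Z) -> perm_eq (x :: Y) (e :: F ++ G) ->
    size F = r.+1 -> size G = r -> col (e :: F) = b -> col (e :: u :: G) = b ->
  [/\ forall f, f \in F -> const_on b Z f,
      forall g, g \in G -> const_on (~~ b) Z g & const_on (~~ b) Z u].
Proof.
move=> pM pL sF sG eF eG; have uV' := uV.
have sZ : 2 * r + 1 <= size Z by have sV' := sV; sizing.
have lZ : r < size Z by sizing.
have opp f g F1 G1 : perm_eq F (f :: F1) -> perm_eq G (g :: G1) ->
    exists b', const_on b' Z f /\ const_on (~~ b') Z g.
  move=> pF pG; apply: not_conn_const_on_opposite => // [|b']; first by counting.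
  have [-> | ne] := eqVneq b' b.
    apply: (@not_conn_disjoint b (e :: u :: F1 ++ G1)); first by counting.
    by exists e, F1, (u :: G1); split; by [counting | sizing | recolor eF | recolor eG].
  have -> : b' = ~~ b by move: ne; case: b'; case: (b).
  apply: (@not_conn_disjoint _ (y :: e :: F1 ++ G1)); first by counting.
  by apply: conn_through_y; counting.
have const_FG f g : f \in F -> g \in G -> const_on b Z f /\ const_on (~~ b) Z g.
  move=> /mem_perm_cons[[|f' F1] pF] /mem_perm_cons[G1 pG]; first by sizing.
  have [b1 [c1 c2]] := opp f g _ _ pF pG.
  have [|b2 [c3 c4]] := opp f' g (f :: F1) G1 _ pG; first by counting.
  have e2 := const_on_inj r_gt0 lZ c2 c4.
  have [e1 | ne] := eqVneq b1 b; first by rewrite -e1.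
  have e1 : b1 = ~~ b by move: ne; case: (b1); case: (b).
  have e3 : b2 = ~~ b by rewrite -e1; move: e2; case: (b1); case: (b2).
  rewrite e1 in c1; rewrite e3 in c3.
  case: (@not_conn_disjoint (~~ b) (y :: e :: F1 ++ G) Z f f').
  - by counting.
  - by apply: conn_through_y; counting.
  - exact: const_on_conn.
case: F sF eF pL opp const_FG => [//|f F1] sF eF pL opp const_FG.
case: G sG eG pL opp const_FG => [|g G1] sG eG pL opp const_FG; first by sizing.
have fF : f \in f :: F1 by rewrite inE eqxx.
have gG : g \in g :: G1 by rewrite inE eqxx.
have [cf cg] := const_FG f g fF gG.
split.
- by move=> f' f'F; have [] := const_FG f' g f'F gG.
- by move=> g' g'G; have [] := const_FG f g' fF g'G.
apply: (not_conn_const_on r_gt0 sZ _ cf); first by counting.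
apply: (@not_conn_disjoint b (e :: g :: F1 ++ G1)); first by counting.
by exists e, (g :: G1), F1; split; by [counting | sizing | recolor eF | recolor eG].
Qed.

(** If the colour were [b], [sides] would make [u] and every [q] of [Q] constant of colour [~~ b] on
    [Z]. Replace [q] by some [p] of [R]: if the new edge has colour [b], [sides] gives [q] the
    colour [b] as well; otherwise [q] and [u] are joined in colour [~~ b] both through [x] and in
    [Z]. *)
Lemma col_other_x u Q R : u \in M -> perm_eq Y (Q ++ R) -> size Q = r ->
  col (u :: x :: Q) = ~~ b.
Proof.
move=> /mem_perm_cons[Z pM] pY sQ; have uV' := uV; have sV' := sV.
have [//|ne] := eqVneq (col (u :: x :: Q)) (~~ b).
have eQ : col (x :: u :: Q) = b.
  by rewrite -(@col_perm _ c (u :: x :: Q));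
    [move: ne; case: (col _); case: (b) | counting].
case: Q sQ eQ pY {ne} => [|q Q] sQ eQ pY; first by sizing.
case: R pY => [|p R] pY; first by sizing.
have [|R1 [R2 [defR sR1 _]]] := @split_at _ r.-1 R; first by sizing.
have eR : col (x :: p :: R) = b by apply: cx; [counting | sizing].
have [||_ cG cu] := sides pM _ _ sQ eR eQ; [by counting | by sizing |].
have cq : const_on (~~ b) Z q by apply: cG; rewrite inE eqxx.
have sZ : 2 * r + 1 <= size Z by sizing.
have lZ : r < size Z by sizing.
have [e | ne] := eqVneq (col (x :: u :: p :: Q)) b.
  have eR' : col (x :: q :: R) = b by apply: cx; [counting | sizing].
  have [|||cF _ _] := sides pM _ _ _ eR' e; try by [counting | sizing].
  have cq' : const_on b Z q by apply: cF; rewrite inE eqxx.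
  by have := const_on_inj r_gt0 lZ cq cq'; case: (b).
case: (@not_conn_disjoint (~~ b) (y :: x :: p :: Q ++ R) Z q u).
- by counting.
- exists x, (y :: R1), (p :: Q); split; try by [sizing | rewrite defR; counting].
  + rewrite -(cy (D := x :: q :: R1)); [|by rewrite defR in pY; counting|by sizing].
    by apply: col_perm; counting.
  + rewrite (@col_perm _ c _ (x :: u :: p :: Q)); last by counting.
    by move: ne; case: (col _); case: (b).
- exact: const_on_conn.
Qed.

(** Edges through [x] are settled by [col_other_x]. An edge of colour [b] avoiding [x] would, by
    [sides], make [u] and a vertex [g] of it constant of colour [~~ b] on [Z], while they are also
    joined in this colour through [x]. *)
Lemma const_other u : u \in M -> const_on (~~ b) (x :: Y) u.
Proof.
move=> uM D DL sD; have uV' := uV; have sV' := sV.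
have [Z pM] := mem_perm_cons uM.
have uD : uniq D by counting.
have [DY | [Q pD QY]] := within_cons uD DL; last first.
  have [R pY] := within_rest QY.
  rewrite -(col_other_x uM pY); [by apply: col_perm; counting | by sizing].
have [F pY] := within_rest DY.
case: D sD pY {DL DY uD} => // e [|g G] sD pY; first by sizing.
have [//|ne] := eqVneq (col (u :: e :: g :: G)) (~~ b).
have eG : col (e :: u :: g :: G) = b.
  rewrite -(@col_perm _ c (u :: e :: g :: G)); last by counting.
  by move: ne; case: (col _); case: (b).
have eF : col (e :: x :: F) = b.
  rewrite -(cx (D := e :: F)); [|by counting|by sizing].
  by apply: col_perm; counting.
have [|||_ cG cu] := sides pM _ _ _ eF eG; try by [counting | sizing].
have cg : const_on (~~ b) Z g by apply: cG; rewrite inE eqxx.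
case: (@not_conn_disjoint (~~ b) (y :: x :: e :: F ++ G) Z g u).
- by counting.
- exists x, (y :: G), F; split; try by [counting | sizing].
  + rewrite -(cy (D := x :: g :: G)); [|by counting|by sizing].
    by apply: col_perm; counting.
  + by apply: (col_other_x (R := e :: g :: G)) => //; [counting | sizing].
- by apply: const_on_conn => //; sizing.
Qed.

(* Induction on [size E]: an edge of the other colour with at least two vertices
   in [M], together with an edge made of [x] and vertices of [Y], contradicts
   [no_path2], the paths being made of edges with fewer vertices in [M]. *)
Lemma col_mixed E F : within E (y :: M) -> within F (x :: Y) ->
  0 < size E -> 0 < size F -> size E + size F = r.+2 -> col (E ++ F) = ~~ b.
Proof.
have uV' := uV.
have [n] := ubnP (size E); elim: n E F => // n IH E F leE EM FL E0 F0 sEF.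
have [//|ne] := eqVneq (col (E ++ F)) (~~ b).
have eEF : col (E ++ F) = b by move: ne; case: (col _); case: (b).
case: E leE EM E0 sEF eEF {ne} => // d [|d' E] leE EM _ sEF eEF.
  have : d \in y :: M by apply: within_mem EM _ _; rewrite inE.
  rewrite inE => /orP[/eqP-> | dM]; first by apply: cy => //; sizing.
  by apply: const_other => //; sizing.
have uF : uniq F by counting.
(* A known edge of colour [b] passes through [x], so [x] is either [e] or [a']. The spare vertex [s]
   exists since [F] has at most [r] vertices. *)
have [e [s [a [a' [G [F' [hL pF sG ea]]]]]]] : exists e s a a' G F',
    [/\ within (e :: s :: a :: a' :: G ++ F') (x :: Y), perm_eq F (e :: F'),
     size G = r.-1 & col (e :: a :: a' :: G) = b].
  have [FY | [Q pQ QY]] := within_cons uF FL.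
    have [R pY] := within_rest FY.
    case: F F0 sEF FY pY {eEF FL uF} => // e F' _ sEF FY pY.
    have [|[|a A] [[|s R'] [defR sA sR]]] := @split_at _ r R; try by sizing.
    exists e, s, a, x, A, F'; rewrite defR in pY.
    split; try by [sizing | counting].
    rewrite -(cx (D := e :: a :: A)); [|by counting|by sizing].
    by apply: col_perm; counting.
  have [R pY] := within_rest QY.
  have [|[|a [|a' A]] [[|s R'] [defR sA sR]]] := @split_at _ r.+1 R; try by sizing.
  exists x, s, a, a', A, Q; rewrite defR in pY.
  split; try by [sizing | counting].
  by apply: cx; [counting | sizing].
(* The edges in [mono] have one vertex in [y :: M], those in [multi] one fewer than the given edge,
   so the induction hypothesis covers both. *)
have mono p q A : within (p :: e :: A) (x :: Y) -> q \in y :: M -> size A = r.-1 ->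
    col (p :: e :: q :: A) = ~~ b.
  move=> hA qM sA; rewrite -(IH [:: q] (p :: e :: A)); try by [counting | sizing].
    by apply: col_perm; counting.
have multi p q : within (p :: e :: F') (x :: Y) -> within (q :: E) (y :: M) ->
    col (p :: e :: q :: E ++ F') = ~~ b.
  move=> hA qM; rewrite -(IH (q :: E) (p :: e :: F')); try by [counting | sizing].
  by apply: col_perm; counting.
have dM : d \in y :: M by apply: within_mem EM _ _; rewrite !inE eqxx.
have d'M : d' \in y :: M by apply: within_mem EM _ _; rewrite !inE eqxx orbT.
have hV : within (e :: s :: a :: a' :: G ++ d :: d' :: E ++ F') V by counting.
case: (@no_path2 b e s a a' G d d' (E ++ F')) => //.
- by sizing.
- by recolor eEF.
- exists e, (d :: G), (d' :: E ++ F'); split; try by [counting | sizing].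
  + by apply: mono => //; counting.
  + by apply: multi; counting.
- exists e, (a :: G), (a' :: E ++ F'); split; try by [counting | sizing].
  + rewrite -(mono a d G) //; [by apply: col_perm; counting | by counting].
  + rewrite -(multi a' d'); [by apply: col_perm; counting | by counting | by counting].
- exists e, (d' :: G), (a' :: E ++ F'); split; try by [counting | sizing].
  + by apply: mono => //; counting.
  + rewrite -(multi a' d); [by apply: col_perm; counting | by counting | by counting].
- exists e, (d :: G), (a' :: E ++ F'); split; try by [counting | sizing].
  + by apply: mono => //; counting.
  + rewrite -(multi a' d'); [by apply: col_perm; counting | by counting | by counting].
- exists e, (d' :: G), (a :: E ++ F'); split; try by [counting | sizing].
  + by apply: mono => //; counting.
  + rewrite -(multi a d); [by apply: col_perm; counting | by counting | by counting].
Qed.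

(** The corners [x], [y], [x'], [y'] of the quadrangle alternate between [x :: Y] and [y :: M], so
    [col_mixed] gives all its edges the colour [~~ b]. *)
Lemma extremal_false : False.
Proof.
have uV' := uV; have sV' := sV.
have [|A [Y' [defY sA sY']]] := @split_at _ r Y; first by sizing.
have [|B [[|x' Y''] [defY' sB sY'']]] := @split_at _ r Y'; try by sizing.
have [|C [M' [defM sC sM']]] := @split_at _ r M; first by sizing.
have [|D [[|y' M''] [defM' sD sM'']]] := @split_at _ r M'; try by sizing.
have pY : perm_eq Y (A ++ B ++ x' :: Y'') by rewrite defY defY'.
have pM : perm_eq M (C ++ D ++ y' :: M'') by rewrite defM defM'.
apply: (no_cycle4 (b := ~~ b)); exists x, y, x', y', A, B, C, D.
split; first by counting.
split; first by split; sizing.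
split.
- rewrite -(col_mixed (E := [:: y]) (F := x :: A)); try by [counting | sizing].
  by apply: col_perm; counting.
- rewrite -(col_mixed (E := [:: y]) (F := x' :: B)); try by [counting | sizing].
- rewrite -(col_mixed (E := y' :: C) (F := [:: x'])); try by [counting | sizing].
  by apply: col_perm; counting.
- rewrite -(col_mixed (E := y' :: D) (F := [:: x])); try by [counting | sizing].
  by apply: col_perm; counting.
Qed.

End Extremal.

(** The path in [Z] excludes paths of colour [b] in [t :: Y], which makes [y] constant on [t :: Y].
    Paths of colour [~~ b] through [y], later also through [t], then let [no_path2] fix the colour
    of [x :: t :: Q] and next of [x :: y :: Q]; the latter extends the constancy of [y] to [x :: Y],
    as [extremal_false] requires. *)
Lemma opposite_conn_false b x y Y t Z :
  perm_eq V (x :: y :: Y ++ t :: Z) -> size Y = 2 * r + 1 ->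
  const_on b Y x -> const_on (~~ b) Y y -> conn b Z x y -> False.
Proof.
move=> pV sY cx cy cZ; have uV' := uV.
have cty : const_on (~~ b) (t :: Y) y.
  move=> D DtY sD; have uD : uniq D by counting.
  have [DY | [Q pD QY]] := within_cons uD DtY; first exact: cy.
  have [R pY] := within_rest QY.
  have [//|ne] := eqVneq (col (y :: D)) (~~ b).
  have eD : col (y :: D) = b by move: ne; case: (col _); case: (b).
  case: Q pD QY pY => [|q Q] pD QY pY; first by sizing.
  have [|R1 [R2 [defR sR1 _]]] := @split_at _ r R; first by sizing.
  rewrite defR in pY; case: (@not_conn_disjoint b Z (t :: Y) x y) => //.
    by counting.
  exists q, R1, (t :: Q); split; try by [counting | sizing].
    by apply: cx; [counting | sizing].
  by recolor eD.
have ypath p q S : perm_eq (t :: Y) (p :: q :: S) -> conn (~~ b) (y :: S) p q.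
  by move=> pS; apply: const_pair_conn cty _ _; [counting | sizing].
have cxt Q R : perm_eq Y (Q ++ R) -> size Q = r -> col (x :: t :: Q) = ~~ b.
  move=> pY sQ; have [//|ne] := eqVneq (col (x :: t :: Q)) (~~ b).
  have eQ : col (x :: t :: Q) = b by move: ne; case: (col _); case: (b).
  case: Q sQ eQ pY {ne} => [|q Q] sQ eQ pY; first by sizing.
  case: R pY => [|d [|d' R]] pY; try by sizing.
  have eR : col (x :: d :: d' :: R) = b by apply: cx; [counting | sizing].
  case: (@no_path2 b x y t q Q d d' R) => //; try by [counting | sizing].
  - apply: (@conn_within _ _ c _ (y :: d :: d' :: Q ++ R)); first by counting.
    by apply: ypath; counting.
  - apply: (@conn_within _ _ c _ (y :: t :: q :: Q ++ R)); first by counting.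
    by apply: ypath; counting.
  - apply: (@conn_within _ _ c _ (y :: q :: d' :: Q ++ R)); first by counting.
    by apply: ypath; counting.
  - apply: (@conn_within _ _ c _ (y :: q :: d :: Q ++ R)); first by counting.
    by apply: ypath; counting.
  - apply: (@conn_within _ _ c _ (y :: t :: d' :: Q ++ R)); first by counting.
    by apply: ypath; counting.
have ydpath d S : perm_eq Y (d :: S) -> conn (~~ b) (x :: t :: S) y d.
  move=> pY; have [|A [B [defS sA sB]]] := @split_at _ r S; first by sizing.
  have [|B1 [B2 [defB sB1 _]]] := @split_at _ r.-1 B; first by sizing.
  rewrite defB in defS; rewrite defS in pY *.
  exists t, A, (x :: B1); split; try by [counting | sizing].
    by apply: cty; [counting | sizing].
  rewrite -(cxt (d :: B1) (A ++ B2)); [|by counting|by sizing].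
  by apply: col_perm; counting.
have cxy Q R : perm_eq Y (Q ++ R) -> size Q = r -> col (x :: y :: Q) = ~~ b.
  move=> pY sQ; have [//|ne] := eqVneq (col (x :: y :: Q)) (~~ b).
  have eQ : col (x :: y :: Q) = b by move: ne; case: (col _); case: (b).
  case: Q sQ eQ pY {ne} => [|q Q] sQ eQ pY; first by sizing.
  case: R pY => [|d [|d' R]] pY; try by sizing.
  have eR : col (x :: d :: d' :: R) = b by apply: cx; [counting | sizing].
  case: (@no_path2 b x t y q Q d d' R) => //; try by [counting | sizing].
  - apply: (@conn_within _ _ c _ (x :: t :: d :: d' :: Q ++ R)); first by counting.
    by apply: ydpath; counting.
  - apply: (@conn_within _ _ c _ (y :: t :: q :: Q ++ R)); first by counting.
    by apply: ypath; counting.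
  - apply: (@conn_within _ _ c _ (x :: t :: q :: d' :: Q ++ R)); first by counting.
    by apply: ydpath; counting.
  - apply: (@conn_within _ _ c _ (x :: t :: q :: d :: Q ++ R)); first by counting.
    by apply: ydpath; counting.
  - apply: (@conn_within _ _ c _ (y :: t :: d' :: Q ++ R)); first by counting.
    by apply: ypath; counting.
apply: (@extremal_false b x y Y (t :: Z)) => //; first by counting.
move=> D DxY sD; have uD : uniq D by counting.
have [DY | [Q pD QY]] := within_cons uD DxY; first exact: cy.
have [R pY] := within_rest QY.
rewrite -(cxy _ _ pY); first by apply: col_perm; counting.
by sizing.
Qed.

(** By [conn_total] the [2 * r + 2] vertices outside carry a path from [x] to [y], which leaves out
    one vertex [t]. If its colour is [~~ b], the roles of [x] and [y] are exchanged. *)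
Lemma not_opposite b x y Y : within (x :: y :: Y) V -> size Y = 2 * r + 1 ->
  const_on b Y x -> const_on (~~ b) Y y -> False.
Proof.
move=> hV sY cx cy; have [X pV] := within_rest hV; have uV' := uV; have sV' := sV.
have [||b' [w [A [B [hX sA sB eA eB]]]]] := @conn_total X x y;
  try by [counting | sizing].
have [Z pX] := within_rest hX.
case: Z pX => [|t [|t' Z]] pX; try by sizing.
have h : conn b' (w :: A ++ B) x y by exists w, A, B; split => // z.
have pV1 : perm_eq V (x :: y :: Y ++ t :: w :: A ++ B) by counting.
have [e | ne] := eqVneq b' b.
  by rewrite e in h; apply: (opposite_conn_false pV1 sY cx cy h).
have e : b' = ~~ b by move: ne; case: (b'); case: (b).
have pV' : perm_eq V (y :: x :: Y ++ t :: w :: A ++ B) by counting.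
rewrite e in h; rewrite -[b]negbK in cx.
exact: (opposite_conn_false pV' sY cy cx (conn_sym h)).
Qed.

End Quadrangle.

Lemma cycle4_exists (T : finType) (r : nat) (c : {set T} -> bool) (V : seq T) :
  0 < r -> uniq V -> size V = 4 * r + 5 -> exists b, cycle4 r c b.
Proof.
move=> r_gt0 uV sV; apply: NNPP => nc.
have no_cycle4 b : ~ cycle4 r c b by move=> cb; apply: nc; exists b.
have [b [x [y [Y [hV sY cx cy]]]]] := exists_opposite r_gt0 uV sV no_cycle4.
exact: (not_opposite r_gt0 uV sV no_cycle4 hV sY cx cy).
Qed.

(** * Stars *)

Section Star.

Variables (T : finType) (r : nat) (c : {set T} -> bool) (S : seq T).
Hypothesis r_gt0 : 0 < r.
Hypothesis sS : size S = r.
Hypothesis no_star : forall b, ~ star3 r c b.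
Implicit Types (A B K P Q : seq T) (h : bool).
Local Notation col := (col c).

(* Two edges meeting only in [u] and leaving out only [a] and [S] complete
   [u, a, S] to a star, which relates [link] to the colours of complementary
   halves of the vertices outside [S]. *)
Definition link u a := col (u :: a :: S).
Definition both h K K' := col K = h /\ col K' = h.

Lemma link_sym u a : link u a = link a u.
Proof. by apply: col_perm; counting. Qed.

Lemma both_sym h K K' : both h K K' -> both h K' K.
Proof. by case. Qed.

Lemma both_perm h K K' L L' :
  perm_eq K L -> perm_eq K' L' -> both h K K' -> both h L L'.
Proof.
move=> p p' [e e'].
by split; [rewrite -e | rewrite -e']; apply: col_perm; rewrite perm_sym.
Qed.

Lemma no_star_at u a P Q h : uniq (S ++ u :: a :: P ++ Q) ->
  size P = r.+1 -> size Q = r.+1 -> col (u :: P) = h -> col (u :: Q) = h ->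
  link u a != h.
Proof.
move=> uni sP sQ eP eQ; apply/eqP => eS; apply: (no_star (b := h)).
exists u, P, Q, (a :: S); split; first by counting.
by split; split => //; sizing.
Qed.

(** Together with one of the given edges and the link of [u] and [a], an edge [a :: P] or [u :: Q]
    of colour [h] would form a star centred at [a] or [u]. *)
Lemma both_swap h u a P Q : uniq (S ++ u :: a :: P ++ Q) ->
  size P = r.+1 -> size Q = r.+1 -> both h (u :: P) (a :: Q) -> link u a = h ->
  both (~~ h) (a :: P) (u :: Q).
Proof.
move=> uni sP sQ [eP eQ] e; split.
  have [e' | ] := eqVneq (col (a :: P)) h; last by case: (col _); case: (h).
  have uni' : uniq (S ++ a :: u :: P ++ Q) by counting.
  by have := no_star_at uni' sP sQ e' eQ; rewrite link_sym e eqxx.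
have [e' | ] := eqVneq (col (u :: Q)) h; last by case: (col _); case: (h).
by have := no_star_at uni sP sQ eP e'; rewrite e eqxx.
Qed.

(** Exchanging [p] and [q] flips the colours whatever their link: if it is not [h], exchange [u]
    with [a], then [p] with [q], then [u] with [a] again, which flips three times. *)
Lemma both_swap_other h u a p q P Q : uniq (S ++ u :: a :: p :: q :: P ++ Q) ->
  size P = r -> size Q = r -> both h (u :: p :: P) (a :: q :: Q) -> link u a = h ->
  both (~~ h) (u :: q :: P) (a :: p :: Q).
Proof.
move=> uni sP sQ bh e; have [epq | ne] := eqVneq (link p q) h.
  apply: (@both_perm _ (q :: u :: P) (p :: a :: Q)); [by counting | by counting |].
  apply: both_swap => //; try by [counting | sizing].
  by apply: both_perm bh; counting.
have bh' : both (~~ h) (a :: p :: P) (u :: q :: Q).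
  by apply: both_swap => //; by [counting | sizing].
have bh'' : both h (q :: a :: P) (p :: u :: Q).
  rewrite -[h]negbK; apply: both_swap; try by [counting | sizing].
    by apply: both_perm bh'; counting.
  by move: ne; case: (link _ _); case: (h).
apply: both_swap; try by [counting | sizing].
  by apply: both_perm bh''; counting.
by rewrite link_sym.
Qed.

(** * Spreading the colour of one link to the others *)

Section Propagation.

Variables (h : bool) (u a p p' q q' : T) (P Q : seq T).
Hypothesis uni : uniq (S ++ u :: a :: p :: p' :: q :: q' :: P ++ Q).
Hypothesis sP : size P = r.-1.
Hypothesis sQ : size Q = r.-1.
Hypothesis bh : both h (u :: p :: p' :: P) (a :: q :: q' :: Q).
Hypothesis ua : link u a = h.

Lemma both_exchange s s' t t' : perm_eq [:: s; s'] [:: p; p'] ->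
  perm_eq [:: t; t'] [:: q; q'] ->
  both (~~ h) (u :: t :: s' :: P) (a :: s :: t' :: Q).
Proof.
move=> ps pt; have uni' := uni.
apply: both_swap_other => //; try by [counting | sizing].
by apply: both_perm bh; counting.
Qed.

Lemma not_both K K' : ~ (both h K K' /\ both (~~ h) K K').
Proof. by case=> [[e _] [e' _]]; move: e'; rewrite e; case: (h). Qed.

(** If the link had colour [~~ h], it would allow a second exchange, flipping the halves of [b1]
    back to colour [h]; but the result is also obtained by a single exchange, which gives [~~ h].
    The next two lemmas use the same conflict. *)
Lemma link_uq : link u q' = h.
Proof.
have uni' := uni; have [//|ne] := eqVneq (link u q') h.
have e : link u q' = ~~ h by move: ne; case: (link _ _); case: (h).
have b1 := @both_exchange p p' q q' (perm_refl _) (perm_refl _).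
have b2 := @both_exchange p' p q q' _ (perm_refl _).
case: (@not_both (u :: q :: p :: P) (a :: p' :: q' :: Q)); split.
  apply: (@both_perm _ (u :: p :: q :: P) (q' :: p' :: a :: Q)); try by counting.
  rewrite -[h]negbK; apply: both_swap_other e; try by [counting | sizing].
  by apply: both_perm b1; counting.
by apply: b2; counting.
Qed.

Lemma link_up : link u p = h.
Proof.
have uni' := uni; have [//|ne] := eqVneq (link u p) h.
have e : link u p = ~~ h by move: ne; case: (link _ _); case: (h).
have b1 := @both_exchange p p' q q' (perm_refl _) (perm_refl _).
have b2 := @both_exchange p p' q' q (perm_refl _) _.
case: (@not_both (u :: q' :: p' :: P) (a :: p :: q :: Q)); split.
  apply: (@both_perm _ (u :: q' :: p' :: P) (p :: q :: a :: Q)); try by counting.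
  rewrite -[h]negbK; apply: both_swap_other e; try by [counting | sizing].
  by apply: both_perm b1; counting.
by apply: b2; counting.
Qed.

Lemma link_qq : link q q' = h.
Proof.
have uni' := uni; have [//|ne] := eqVneq (link q q') h.
have e : link q q' = ~~ h by move: ne; case: (link _ _); case: (h).
have b1 := @both_exchange p p' q q' (perm_refl _) (perm_refl _).
have b2 := @both_exchange p' p q q' _ (perm_refl _).
case: (@not_both (u :: q :: p :: P) (a :: p' :: q' :: Q)); split.
  apply: (@both_perm _ (q :: p :: u :: P) (q' :: p' :: a :: Q)); try by counting.
  rewrite -[h]negbK; apply: both_swap_other e; try by [counting | sizing].
  by apply: both_perm b1; counting.
by apply: b2; counting.
Qed.

(** With [u] and [a] exchanged, a link of colour [~~ h] would allow exchanging [p'] with [u] or with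
    [q'], both giving colour [h]. The two results differ by exchanging [u] and [q'], which must flip
    the colour by [link_uq]. *)
Lemma link_pq : link p q = h.
Proof.
have uni' := uni; have [//|ne] := eqVneq (link p q) h.
have e : link p q = ~~ h by move: ne; case: (link _ _); case: (h).
have b1 : both (~~ h) (a :: p :: p' :: P) (u :: q :: q' :: Q).
  by apply: both_swap => //; by [counting | sizing].
have b2 : both h (u :: p :: a :: P) (q' :: q :: p' :: Q).
  apply: (@both_perm _ (p :: u :: a :: P) (q :: p' :: q' :: Q)); try by counting.
  rewrite -[h]negbK; apply: both_swap_other e; try by [counting | sizing].
  by apply: both_perm b1; counting.
have b3 : both h (q' :: p :: a :: P) (u :: q :: p' :: Q).
  apply: (@both_perm _ (p :: q' :: a :: P) (q :: p' :: u :: Q)); try by counting.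
  rewrite -[h]negbK; apply: both_swap_other e; try by [counting | sizing].
  by apply: both_perm b1; counting.
case: (@not_both (q' :: p :: a :: P) (u :: q :: p' :: Q)); split => //.
by apply: both_swap b2 link_uq; by [counting | sizing].
Qed.

End Propagation.

(** The positions of [s] and [t] relative to [u] and [a] are covered by the four preceding lemmas,
    with the two halves exchanged where necessary. *)
Lemma link_constant_half h K K' u a : uniq (S ++ K ++ K') ->
    size K = r.+2 -> size K' = r.+2 -> both h K K' ->
    u \in K -> a \in K' -> link u a = h ->
  forall s t, s != t -> t \in K' -> s \in K ++ K' -> link s t = h.
Proof.
move=> uni sK sK' bh uK aK' ua.
have [P0 pK] := mem_perm_cons uK; have [Q0 pK'] := mem_perm_cons aK'.
have sym L : both h K K' -> perm_eq K' L -> both h L K.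
  by move=> [e e'] pL; split => //; rewrite -e'; apply: col_perm; rewrite perm_sym.
move=> s t st tK'.
have tL : t \in a :: Q0 by rewrite -(perm_mem pK').
rewrite mem_cat (perm_mem pK) (perm_mem pK') => /orP[]; last first.
- case: P0 pK => [|p [|p' P]] pK; try by sizing.
  move: tL; rewrite inE => /orP[/eqP ta | tQ].
    rewrite inE -ta (negPf st) /= => sQ.
    have [[|q' Q] pQ] := mem_perm_cons sQ; first by sizing.
    rewrite ta link_sym.
    apply: (@link_up h a u s q' p p' Q P); try by [counting | sizing].
      by apply: both_sym; apply: both_perm bh; counting.
    by rewrite link_sym.
  rewrite inE => /orP[/eqP-> | sQ].
    have [[|q' Q] pQ] := mem_perm_cons tQ; first by sizing.
    apply: (@link_up h a u t q' p p' Q P); try by [counting | sizing].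
      by apply: both_sym; apply: both_perm bh; counting.
    by rewrite link_sym.
  have [Q1 pQ] := mem_perm_cons tQ.
  have sQ1 : s \in Q1.
    by move: sQ; rewrite (perm_mem pQ) inE (negPf st).
  have [Q pQ1] := mem_perm_cons sQ1.
  apply: (@link_qq h u a p p' s t P Q) => //; try by [counting | sizing].
  by apply: both_perm bh; counting.
rewrite inE => /orP[/eqP-> | sP].
  move: tL; rewrite inE => /orP[/eqP-> // | tQ].
  have [[|q' Q] pQ] := mem_perm_cons tQ; first by sizing.
  case: P0 pK => [|p [|p' P]] pK; try by sizing.
  apply: (@link_uq h u a p p' q' t P Q) => //; try by [counting | sizing].
  by apply: both_perm bh; counting.
have [[|p' P] pP] := mem_perm_cons sP; first by sizing.
move: tL; rewrite inE => /orP[/eqP-> | tQ].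
  case: Q0 pK' => [|q [|q' Q]] pK'; try by sizing.
  rewrite link_sym; apply: (@link_uq h a u q q' p' s Q P); try by [counting | sizing].
    by apply: both_sym; apply: both_perm bh; counting.
  by rewrite link_sym.
have [[|q' Q] pQ] := mem_perm_cons tQ; first by sizing.
apply: (@link_pq h u a s p' t q' P Q) => //; try by [counting | sizing].
by apply: both_perm bh; counting.
Qed.

Lemma link_constant h K K' u a : uniq (S ++ K ++ K') ->
    size K = r.+2 -> size K' = r.+2 -> both h K K' ->
    u \in K -> a \in K' -> link u a = h ->
  forall s t, s != t -> s \in K ++ K' -> t \in K ++ K' -> link s t = h.
Proof.
move=> uni sK sK' bh uK aK' ua s t st sKK'; rewrite mem_cat => /orP[tK | tK'].
  apply: (@link_constant_half h K' K a u) => //; first by counting.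
  - exact: both_sym.
  - by rewrite link_sym.
  - by move: sKK'; rewrite !mem_cat orbC.
exact: (link_constant_half uni sK sK' bh uK aK' ua).
Qed.

(** Otherwise an edge at [u] and the complementary edge at [u'] always have different colours. *)
Lemma separated u u' W : uniq (S ++ u :: u' :: W) -> size W = 2 * r + 2 ->
  exists h P Q, perm_eq W (P ++ Q) /\
    [/\ size P = r.+1, size Q = r.+1 & both h (u :: P) (u' :: Q)].
Proof.
move=> uni sW; apply: NNPP => nex.
have opp P Q : perm_eq W (P ++ Q) -> size P = r.+1 -> col (u' :: Q) = ~~ col (u :: P).
  move=> pW sP; have [e | ] := eqVneq (col (u' :: Q)) (col (u :: P)).
    by case: nex; exists (col (u :: P)), P, Q; split => //; split => //; sizing.
  by case: (col _); case: (col _).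
(* If exchanging [p] for [q] changed the colour, then by [opp] the edges [u :: p :: A] and
   [u' :: p :: B] would agree, and likewise those with [q]; [no_star_at] at [p] and at [q] would
   exclude both colours for their link. *)
have same P P' : within P W -> within P' W -> size P = r.+1 -> size P' = r.+1 ->
    col (u :: P) = col (u :: P').
  move=> PW P'W sP sP'.
  apply: (@johnson _ (fun P' => col (u :: P) = col (u :: P')) W r _ _ _ P P') => //.
  - by counting.
  - by move=> A B pAB ->; apply: col_perm; counting.
  move=> p q A hA sA ->; have [B pW] := within_rest hA.
  have e1 := @opp (p :: A) (q :: B); have e2 := @opp (q :: A) (p :: B).
  have [//|ne] := eqVneq (col (u :: p :: A)) (col (u :: q :: A)).
  have e : col (u :: q :: A) = ~~ col (u :: p :: A).
    by move: ne; case: (col _); case: (col _).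
  have l1 : link p q != col (u :: p :: A).
    apply: (@no_star_at p q (u :: A) (u' :: B)); try by [counting | sizing].
      by apply: col_perm; counting.
    rewrite -[RHS]negbK -e -e2; [|by counting|by sizing].
    by apply: col_perm; counting.
  have l2 : link q p != col (u :: q :: A).
    apply: (@no_star_at q p (u :: A) (u' :: B)); try by [counting | sizing].
      by apply: col_perm; counting.
    rewrite e -e1; [|by counting|by sizing].
    by apply: col_perm; counting.
  by move: l1 l2; rewrite link_sym e; case: (link q p); case: (col _).
have [|P [Q [defW sP sQ]]] := @split_at _ r.+1 W; first by sizing.
have e1 : col (u' :: Q) = ~~ col (u :: P) by apply: opp; rewrite ?defW.
have e2 : col (u' :: P) = ~~ col (u :: Q).
  by apply: opp; [rewrite defW; counting | sizing].
have e3 : col (u :: Q) = col (u :: P).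
  by apply: same; [rewrite defW; counting | rewrite defW; counting | sizing | sizing].
rewrite defW in uni.
(* The two edges at [u] agree and the two at [u'] have the opposite colour, so no colour is left for
   [link u u']. *)
have l1 : link u u' != col (u :: P).
  by apply: (@no_star_at u u' P Q); try by [counting | sizing].
have l2 : link u' u != ~~ col (u :: P).
  by apply: (@no_star_at u' u P Q); try by [counting | sizing | rewrite -e3].
by move: l1 l2; rewrite link_sym; case: (link _ _); case: (col _).
Qed.

(** Otherwise [K'] lies in [L] and equals it by size, although [s] belongs to [L] and not to
    [K']. *)
Lemma cross_pair K K' L L' s : uniq (K ++ K') -> uniq (L ++ L') ->
  perm_eq (K ++ K') (L ++ L') -> size K' = size L -> s \in K -> s \in L ->
  exists2 t, t \in K' & t \in L'.
Proof.
move=> uK uL pKL sK sKin sL.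
have [/hasP[t tK' tL'] | nh] := boolP (has (mem L') K'); first by exists t.
have K'L : {subset K' <= L}.
  move=> t tK'; have : t \in L ++ L' by rewrite -(perm_mem pKL) mem_cat tK' orbT.
  rewrite mem_cat => /orP[//|tL']; case/negP: nh; apply/hasP; by exists t.
have uK' : uniq K' by counting.
have [_ eKL] := uniq_min_size uK' K'L (eq_leq (esym sK)).
have sK' : s \in K' by rewrite eKL.
by move: uK; rewrite cat_uniq => /and3P[_ /hasP[]]; exists s.
Qed.

(** A link of colour [h] across two halves of colour [h] makes all links [h], by [link_constant]. So
    halves separating [s] and [t] have colour [false], those separating [s'] and [t'] colour [true].
    By [cross_pair] some [s], [z] are separated by both divisions, and their link agrees with one of
    them. *)
Lemma link_not_monochromatic s t s' t' W : uniq (S ++ W) -> size W = 2 * r + 4 ->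
  within [:: s; t] W -> within [:: s'; t'] W -> link s t = true ->
  link s' t' = false -> False.
Proof.
move=> uni sW stW stW' e e'.
have sep u v : within [:: u; v] W -> exists h P Q, perm_eq W (u :: P ++ v :: Q) /\
    [/\ size P = r.+1, size Q = r.+1 & both h (u :: P) (v :: Q)].
  move=> uvW; have [W' pW] := within_rest uvW.
  have [||h [P [Q [pW' [sP sQ bh]]]]] := @separated u v W'; try by [counting | sizing].
  by exists h, P, Q; split => //; counting.
have const h K K' u a : perm_eq W (K ++ K') -> size K = r.+2 -> size K' = r.+2 ->
    both h K K' -> u \in K -> a \in K' -> link u a = h -> False.
  move=> pW sK sK' bh uK aK' ua.
  have all_h x y : within [:: x; y] W -> link x y = h.
    move=> xyW; have xyW' := within_mem xyW.
    apply: (link_constant _ sK sK' bh uK aK' ua); first by counting.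
    - have : uniq [:: x; y] by counting.
      by rewrite /= inE andbT.
    - by rewrite -(perm_mem pW) xyW' // inE eqxx.
    - by rewrite -(perm_mem pW) xyW' // !inE eqxx orbT.
  by move: e e'; rewrite !all_h // => ->.
have [h1 [P [Q [pW [sP sQ bh]]]]] := sep s t stW.
have [h2 [P' [Q' [pW' [sP' sQ' bh']]]]] := sep s' t' stW'.
have h1F : h1 = false.
  case: h1 bh => // bh.
  by case: (const true (s :: P) (t :: Q) s t); rewrite ?inE ?eqxx //; sizing.
have h2T : h2 = true.
  case: h2 bh' => // bh'.
  by case: (const false (s' :: P') (t' :: Q') s' t'); rewrite ?inE ?eqxx //; sizing.
subst h1 h2.
have cross L L' : perm_eq W (L ++ L') -> size L = r.+2 -> size L' = r.+2 ->
    both true L L' -> s \in L -> False.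
  move=> pL sL sL' bL sinL.
  have sK : size (t :: Q) = size L by sizing.
  have [|||||z zQ zL'] := @cross_pair (s :: P) (t :: Q) L L' s _ _ _ sK;
    rewrite ?inE ?eqxx //; try by counting.
  case ez: (link s z).
    exact: (const true L L' s z).
  apply: (const false (s :: P) (t :: Q) s z) => //; rewrite ?inE ?eqxx //; sizing.
have : s \in (s' :: P') ++ (t' :: Q').
  by rewrite -(perm_mem pW') (perm_mem pW) inE eqxx.
rewrite mem_cat => /orP[sin | sin].
  by apply: (cross (s' :: P') (t' :: Q')) => //; sizing.
apply: (cross (t' :: Q') (s' :: P')) => //; try by [counting | sizing].
exact: both_sym.
Qed.

End Star.

Lemma star3_exists (T : finType) (r : nat) (c : {set T} -> bool) :
  0 < r -> #|T| = 3 * r + 4 -> exists b, star3 r c b.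
Proof.
move=> r_gt0 sT; apply: NNPP => nc.
have no_star b : ~ star3 r c b by move=> cb; apply: nc; exists b.
have [b hb | b [x [y [A [uA sA ex ey]]]]] := @not_constant T r c _.
  apply: (no_star b).
  have uW : uniq (enum T) by apply: enum_uniq.
  have sW : size (enum T) = 3 * r + 4 by rewrite -cardE.
  case: (enum T) uW sW => [|x W] uW sW; first by sizing.
  have [|A [BC [defW sA sBC]]] := @split_at _ r.+1 W; first by sizing.
  have [|B [C [defBC sB sC]]] := @split_at _ r.+1 BC; first by sizing.
  rewrite defW defBC in uW.
  exists x, A, B, C; split; first by counting.
  split; first by split; sizing.
  by split; apply: hb; (counting || sizing).
have [W [uW sW]] := uniq_rest uA.
(* The two edges of different colours become the links of [x], [v] and of [y], [v]. *)
case: A sA uA ex ey uW sW => [|v S] sA uA ex ey uW sW; first by sizing.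
have sS : size S = r by sizing.
have uW' : uniq (S ++ x :: y :: v :: W) by counting.
have sW' : size (x :: y :: v :: W) = 2 * r + 4 by sizing.
have [xv yv] : within [:: x; v] (x :: y :: v :: W) /\
    within [:: y; v] (x :: y :: v :: W) by split; counting.
have nlm := link_not_monochromatic r_gt0 sS no_star uW' sW'.
by case: b ex ey => ex ey; [apply: nlm xv yv ex ey | apply: nlm yv xv ey ex].
Qed.

(** * From cycles to paths *)

Section Derived.

Variables (T : finType) (r : nat) (c : {set T} -> bool).
Hypothesis r_gt0 : 0 < r.
Implicit Types (A B C D : seq T) (b : bool).
Local Notation col := (col c).

Lemma recolored (P : Prop) b A : ~ P -> (col A = b -> P) -> col A = ~~ b.
Proof.
move=> nP h; have [e | ] := eqVneq (col A) b; first by case: nP; apply: h.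
by case: (col A); case: b h.
Qed.

Lemma spare A n : uniq A -> size A + n <= #|T| ->
  exists W, size W = n /\ uniq (A ++ W).
Proof.
move=> uA sA; have [W [uW sW]] := uniq_rest uA.
have [|W1 [W2 [defW sW1 _]]] := @split_at _ n W; first by sizing.
by exists W1; split => //; rewrite defW in uW; counting.
Qed.

(** Without a triangle of colour [b], any third side closing two edges of colour [b] that share a
    vertex has colour [~~ b]. Four such third sides, one using the spare vertex [s], form a
    quadrangle with corners [x], [z], [d], [t]. *)
Lemma cycle4_cycle3 b : 4 * r + 5 <= #|T| -> cycle4 r c b ->
  cycle4 r c (~~ b) \/ cycle3 r c b.
Proof.
move=> sT [x [y [z [t [A [B [C [D [uni [[sA sB sC sD] [eA eB eC eD]]]]]]]]]]].
have [|[|s [|s' W]] [sW us]] := @spare (x :: y :: z :: t :: A ++ B ++ C ++ D) 1 uni;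
  try by sizing.
have [n3 | y3] := classic (~ cycle3 r c b); last by right; apply: NNPP.
have closing o p q P Q Z : uniq (o :: p :: q :: P ++ Q ++ Z) ->
    size P = r -> size Q = r -> size Z = r -> col (o :: p :: P) = b ->
    col (o :: q :: Q) = b -> col (p :: q :: Z) = ~~ b.
  move=> u sP sQ sZ eP eQ; apply: (recolored n3) => eZ.
  exists p, o, q, P, Q, Z; split; first by counting.
  by do 2!split => //; [recolor eP | recolor eZ].
case: A sA uni us eA => [|p A] sA uni us eA; first by sizing.
case: B sB uni us eB => [|q B] sB uni us eB; first by sizing.
case: C sC uni us eC => [|v C] sC uni us eC; first by sizing.
case: D sD uni us eD => [|d D] sD uni us eD; first by sizing.
left; exists x, z, d, t, (s :: B), (p :: C), (y :: A), (q :: D).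
split; first by counting.
split; first by split; sizing.
split.
- apply: (closing t _ _ (d :: D) (v :: C)); try by [counting | sizing | recolor eD].
  by recolor eC.
- rewrite -(closing y p z (x :: A) (q :: B) (d :: C));
    try by [counting | sizing | recolor eA | recolor eB].
  by apply: col_perm; counting.
- rewrite -(closing z y t (q :: B) (v :: C) (d :: A));
    try by [counting | sizing | recolor eB | recolor eC].
  by apply: col_perm; counting.
- rewrite -(closing y x q (p :: A) (z :: B) (t :: D));
    try by [counting | sizing | recolor eA | recolor eB].
  by apply: col_perm; counting.
Qed.

(** Replacing a corner of a side by a spare vertex gives an edge attached to the path of the other
    two sides at an end, hence of colour [~~ b] if there is no path of colour [b]. These edges make
    up the new path and, with one side modified in two vertices, the new triangle. *)
Lemma cycle3_path3 b : 3 * r + 5 <= #|T| -> cycle3 r c b ->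
  path3 r c b \/ (cycle3 r c (~~ b) /\ path3 r c (~~ b)).
Proof.
move=> sT [x [y [z [A [B [C [uni [[sA sB sC] [eA eB eC]]]]]]]]].
have [|[|w [|w' [|w'' W]]] [sW us]] := @spare (x :: y :: z :: A ++ B ++ C) 2 uni;
  try by sizing.
have [n3 | y3] := classic (~ path3 r c b); last by left; apply: NNPP.
have detour o p P Q R : uniq (o :: p :: P ++ Q ++ R) ->
    size P = r.+1 -> size Q = r -> size R = r.+1 ->
    col (o :: p :: Q) = b -> col (p :: R) = b -> col (o :: P) = ~~ b.
  move=> u sP sQ sR eQ eR; apply: (recolored n3) => eP.
  by exists o, p, P, Q, R.
have e1 : col (x :: w :: A) = ~~ b.
  by apply: (detour x z _ C (y :: B)); by [counting | sizing | recolor eC | recolor eB].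
have e2 : col (x :: w' :: C) = ~~ b.
  by apply: (detour x y _ A (z :: B)); by [counting | sizing | recolor eA | recolor eB].
have e3 : col (z :: w :: B) = ~~ b.
  by apply: (detour z x _ C (y :: A)); by [counting | sizing | recolor eC | recolor eA].
have e4 : col (z :: w' :: C) = ~~ b.
  by apply: (detour z y _ B (x :: A)); by [counting | sizing | recolor eB | recolor eA].
right; split; last first.
  exists w, z, (x :: A), B, (w' :: C); split; first by counting.
  by split; split; by [sizing | recolor e1 | recolor e3 | recolor e4].
case: B sB uni us eB {e3} => [|v B] sB uni us eB; first by sizing.
have e5 : col (y :: w :: w' :: B) = ~~ b.
  by apply: (detour y x _ A (z :: C)); by [counting | sizing | recolor eA | recolor eC].
exists x, w, w', A, (y :: B), C; split; first by counting.
by split; split; by [sizing | recolor e1 | recolor e5 | recolor e2].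
Qed.

(** As for triangles, a side with a corner replaced by a spare vertex is attached to the path of the
    other three sides at an end. *)
Lemma cycle4_path4 b : 4 * r + 6 <= #|T| -> cycle4 r c b ->
  path4 r c b \/
  [/\ cycle4 r c (~~ b), cycle3 r c (~~ b) & path4 r c (~~ b)].
Proof.
move=> sT [x [y [z [t [A [B [C [D [uni [[sA sB sC sD] [eA eB eC eD]]]]]]]]]]].
have [|[|w [|w' [|w'' W]]] [sW us]]
  := @spare (x :: y :: z :: t :: A ++ B ++ C ++ D) 2 uni;
  try by sizing.
have [n4 | y4] := classic (~ path4 r c b); last by left; apply: NNPP.
have detour o p q P Q R S : uniq (o :: p :: q :: P ++ Q ++ R ++ S) ->
    size P = r.+1 -> size Q = r -> size R = r -> size S = r.+1 ->
    col (o :: p :: Q) = b -> col (p :: q :: R) = b -> col (q :: S) = b ->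
    col (o :: P) = ~~ b.
  move=> u sP sQ sR sS eQ eR eS; apply: (recolored n4) => eP.
  by exists o, p, q, P, Q, R, S.
have e1 : col (y :: w :: A) = ~~ b.
  by apply: (detour y z t _ B C (x :: D));
    by [counting | sizing | recolor eB | recolor eC | recolor eD].
have e2 : col (y :: w' :: B) = ~~ b.
  by apply: (detour y x t _ A D (z :: C));
    by [counting | sizing | recolor eA | recolor eD | recolor eC].
have e3 : col (t :: w' :: C) = ~~ b.
  by apply: (detour t x y _ D A (z :: B));
    by [counting | sizing | recolor eD | recolor eA | recolor eB].
have e4 : col (t :: w :: D) = ~~ b.
  by apply: (detour t z y _ C B (x :: A));
    by [counting | sizing | recolor eC | recolor eB | recolor eA].
have e5 : col (x :: w :: A) = ~~ b.
  by apply: (detour x t z _ D C (y :: B));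
    by [counting | sizing | recolor eD | recolor eC | recolor eB].
have e6 : col (z :: w :: B) = ~~ b.
  by apply: (detour z t x _ C D (y :: A));
    by [counting | sizing | recolor eC | recolor eD | recolor eA].
have e7 : col (z :: w' :: C) = ~~ b.
  by apply: (detour z y x _ B A (t :: D));
    by [counting | sizing | recolor eB | recolor eA | recolor eD].
have e8 : col (t :: w' :: D) = ~~ b.
  by apply: (detour t z y _ C B (x :: A));
    by [counting | sizing | recolor eC | recolor eB | recolor eA].
right; split.
- exists w, y, w', t, A, B, C, D; split; first by counting.
  by split; split; by [sizing | recolor e1 | recolor e2 | recolor e3 | recolor e4].
- case: C sC uni us eC {e3 e7} => [|v C] sC uni us eC; first by sizing.
  have e9 : col (z :: w :: w' :: C) = ~~ b.
    by apply: (detour z y x _ B A (t :: D));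
      by [counting | sizing | recolor eB | recolor eA | recolor eD].
  exists y, w, w', A, (z :: C), B; split; first by counting.
  by split; split; by [sizing | recolor e1 | recolor e9 | recolor e2].
- exists w, z, w', (x :: A), B, C, (t :: D); split; first by counting.
  by split; split; by [sizing | recolor e5 | recolor e6 | recolor e7 | recolor e8].
Qed.

Lemma cycle4_contains_path3 b : cycle4 r c b -> path3 r c b.
Proof.
move=> [x [y [z [t [A [B [C [D [uni [[sA sB sC sD] [eA eB eC eD]]]]]]]]]]].
exists y, z, (x :: A), B, (t :: C); split; first by counting.
by split; split; by [sizing | recolor eA | recolor eB | recolor eC].
Qed.

End Derived.

(** * Copies from sequences *)

Section Copies.

Variable F : hypergraph.
Implicit Types (s p q l : seq F).

Definition edge_at k (s : seq F) a := exists p l q,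
  [/\ s = p ++ l ++ q, size p = a, size l = k & [set z in l] \in edges F].

Lemma edge_at_slice k s a : edge_at k s a ->
  [set z in take k (drop a s)] \in edges F.
Proof.
by move=> [p [l [q [-> <- <- e]]]]; rewrite drop_size_cat // take_size_cat.
Qed.

Lemma mem_slice x0 k s a z : reflect
  (exists2 j, j < k & a + j < size s /\ z = nth x0 s (a + j))
  (z \in take k (drop a s)).
Proof.
apply: (iffP idP) => [zs | [j jk [js ->]]].
  have := zs; rewrite -index_mem size_take_min size_drop leq_min ltn_subRL.
  set j := index z _ => /andP[jk js]; exists j => //; split => //.
  by rewrite -nth_drop -(@nth_take k) // nth_index.
rewrite -nth_drop -(@nth_take k) //; apply: mem_nth.
by rewrite size_take_min size_drop leq_min jk ltn_subRL.
Qed.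

Lemma loose_path_copy k n s : uniq s -> size s = (n * k.-1).+1 ->
  (forall i, i < n -> edge_at k s (i * k.-1)) -> contains_copy (loose_path k n) F.
Proof.
case: s => // x s us ss es.
exists (fun v : 'I_(n * k.-1).+1 => nth x (x :: s) v).
  by move=> u v /eqP; rewrite nth_uniq ?ss // => /eqP; apply: val_inj.
move=> _ /imsetP[i _ ->].
rewrite (_ : _ @: _ = [set z in take k (drop (i * k.-1) (x :: s))]);
  first by apply: edge_at_slice; apply: es.
apply/setP => z; symmetry.
rewrite inE; apply/idP/imsetP => [zs | [v]].
  have [j jk [js ->]] := elimT (mem_slice x _ _ _ _) zs.
  rewrite ss in js; exists (Ordinal js) => //.
  by rewrite inE; apply/existsP; exists (Ordinal jk); rewrite /= addnC.
rewrite inE => /existsP[j /eqP vj] ->; apply: (introT (mem_slice x _ _ _ _));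
  exists (j : nat) => //.
by rewrite addnC -vj ss ltn_ord.
Qed.

(** Repeating [x] at the end of the sequence turns the last edge, which wraps around, into a
    slice. *)
Lemma loose_cycle_copy k n x s : 0 < n -> uniq (x :: s) -> size (x :: s) = n * k.-1 ->
  (forall i, i < n -> edge_at k (rcons (x :: s) x) (i * k.-1)) ->
  contains_copy (loose_cycle k n) F.
Proof.
move=> n_gt0 us ss es.
exists (fun v : 'I_(n * k.-1) => nth x (x :: s) v).
  by move=> u v /eqP; rewrite nth_uniq ?ss // => /eqP; apply: val_inj.
have nth_mod a : a <= n * k.-1 ->
    nth x (rcons (x :: s) x) a = nth x (x :: s) (a %% (n * k.-1)).
  rewrite nth_rcons ss leq_eqVlt => /orP[/eqP-> | lt].
    by rewrite ltnn eqxx modnn.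
  by rewrite lt modn_small.
move=> _ /imsetP[i _ ->].
rewrite (_ : _ @: _ = [set z in take k (drop (i * k.-1) (rcons (x :: s) x))]);
  first by apply: edge_at_slice; apply: es.
apply/setP => z; symmetry.
have le j : j < k -> j + i * k.-1 <= n * k.-1.
  by move=> jk; have := ltn_ord i; nia.
rewrite inE; apply/idP/imsetP => [zs | [v]].
  have [j jk [js ->]] := elimT (mem_slice x _ _ _ _) zs.
  have lt : (j + i * k.-1) %% (n * k.-1) < n * k.-1 by rewrite ltn_mod -ss.
  exists (Ordinal lt); last by rewrite addnC nth_mod //; apply: le.
  by rewrite inE; apply/existsP; exists (Ordinal jk).
rewrite inE => /existsP[j /eqP vj] ->; apply: (introT (mem_slice x _ _ _ _));
  exists (j : nat) => //.
by rewrite size_rcons ss ltnS addnC le // nth_mod ?le // vj.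
Qed.

Lemma star_copy k n x s : uniq (x :: s) -> size s = n * k.-1 ->
  (forall i, i < n -> [set z in x :: take k.-1 (drop (i * k.-1) s)] \in edges F) ->
  contains_copy (star k n) F.
Proof.
move=> /andP[xs us] ss es.
exists (fun v : option 'I_(n * k.-1) => if v is Some i then nth x s i else x).
  move=> [u|] [v|] //= => [/eqP | e | e].
  - by rewrite nth_uniq ?ss // => /eqP/val_inj->.
  - by rewrite -e mem_nth ?ss in xs.
  - by rewrite e mem_nth ?ss in xs.
move=> _ /imsetP[i _ ->].
rewrite (_ : _ @: _ = [set z in x :: take k.-1 (drop (i * k.-1) s)]);
  first by apply: es.
apply/setP => z; symmetry.
rewrite imsetU1 -imset_comp !inE; case: eqP => //= _.
apply/idP/imsetP => [zs | [v]].
  have [j jk [js ->]] := elimT (mem_slice x _ _ _ _) zs.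
  rewrite ss in js; exists (Ordinal js) => //.
  by rewrite inE; apply/existsP; exists (Ordinal jk); rewrite /= addnC.
rewrite inE => /existsP[j /eqP vj] ->; apply: (introT (mem_slice x _ _ _ _));
  exists (j : nat) => //=.
by rewrite addnC -vj ss ltn_ord.
Qed.

End Copies.

(** * Monochromatic cycles, paths and stars as copies *)

Section ColorCopies.

Variables (T : finType) (r : nat) (c : {set T} -> bool) (b : bool).
Local Notation F := (@Hypergraph T [set e : {set T} | (#|e| == r.+2) && (c e == b)]).
Implicit Types (A B C D l s p q : seq T).

Lemma color_edge l : uniq l -> size l = r.+2 -> col c l = b ->
  [set z in l] \in edges F.
Proof.
by move=> ul sl el; rewrite inE /= -sl cardsE (card_uniqP ul) eqxx; apply/eqP.
Qed.

Lemma color_edge_at s p l q a : uniq l -> s = p ++ l ++ q -> size p = a ->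
  size l = r.+2 -> col c l = b -> @edge_at F r.+2 s a.
Proof.
by move=> ul es sp sl el; exists p, l, q; split => //; apply: color_edge.
Qed.

Lemma cycle3_copy : cycle3 r c b -> contains_copy (loose_cycle r.+2 3) F.
Proof.
move=> [x [y [z [A [B [C [uni [[sA sB sC] [eA eB eC]]]]]]]]].
have us : uniq (x :: A ++ y :: B ++ z :: C) by counting.
have sz : size (x :: A ++ y :: B ++ z :: C) = 3 * r.+1 by sizing.
apply: (@loose_cycle_copy F _ _ x (A ++ y :: B ++ z :: C)) => //.
move=> [|[|[|//]]] _.
- apply: (@color_edge_at (rcons (x :: A ++ y :: B ++ z :: C) x)
    [::] (x :: A ++ [:: y]) (B ++ z :: C ++ [:: x]));
    try by [counting | sizing | recolor eA].
  by rewrite -cats1 /= -?catA /= -?catA.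
- apply: (@color_edge_at (rcons (x :: A ++ y :: B ++ z :: C) x)
    (x :: A) (y :: B ++ [:: z]) (C ++ [:: x]));
    try by [counting | sizing | recolor eB].
  by rewrite -cats1 /= -?catA /= -?catA.
- apply: (@color_edge_at (rcons (x :: A ++ y :: B ++ z :: C) x)
    (x :: A ++ y :: B) (z :: C ++ [:: x]) [::]);
    try by [counting | sizing | recolor eC].
  by rewrite -cats1 /= -?catA /= -?catA ?cats0.
Qed.

Lemma cycle4_copy : cycle4 r c b -> contains_copy (loose_cycle r.+2 4) F.
Proof.
move=> [x [y [z [t [A [B [C [D [uni [[sA sB sC sD] [eA eB eC eD]]]]]]]]]]].
have us : uniq (x :: A ++ y :: B ++ z :: C ++ t :: D) by counting.
have sz : size (x :: A ++ y :: B ++ z :: C ++ t :: D) = 4 * r.+1 by sizing.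
apply: (@loose_cycle_copy F _ _ x (A ++ y :: B ++ z :: C ++ t :: D)) => //.
move=> [|[|[|[|//]]]] _.
- apply: (@color_edge_at (rcons (x :: A ++ y :: B ++ z :: C ++ t :: D) x)
    [::] (x :: A ++ [:: y]) (B ++ z :: C ++ t :: D ++ [:: x]));
    try by [counting | sizing | recolor eA].
  by rewrite -cats1 /= -?catA /= -?catA /= -?catA.
- apply: (@color_edge_at (rcons (x :: A ++ y :: B ++ z :: C ++ t :: D) x)
    (x :: A) (y :: B ++ [:: z]) (C ++ t :: D ++ [:: x]));
    try by [counting | sizing | recolor eB].
  by rewrite -cats1 /= -?catA /= -?catA /= -?catA.
- apply: (@color_edge_at (rcons (x :: A ++ y :: B ++ z :: C ++ t :: D) x)
    (x :: A ++ y :: B) (z :: C ++ [:: t]) (D ++ [:: x]));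
    try by [counting | sizing | recolor eC].
  by rewrite -cats1 /= -?catA /= -?catA /= -?catA.
- apply: (@color_edge_at (rcons (x :: A ++ y :: B ++ z :: C ++ t :: D) x)
    (x :: A ++ y :: B ++ z :: C) (t :: D ++ [:: x]) [::]);
    try by [counting | sizing | recolor eD].
  by rewrite -cats1 /= -?catA /= -?catA /= -?catA ?cats0.
Qed.

Lemma path3_copy : path3 r c b -> contains_copy (loose_path r.+2 3) F.
Proof.
move=> [x [y [A [B [C [uni [[sA sB sC] [eA eB eC]]]]]]]].
have us : uniq (A ++ x :: B ++ y :: C) by counting.
have sz : size (A ++ x :: B ++ y :: C) = (3 * r.+1).+1 by sizing.
apply: (@loose_path_copy F _ _ (A ++ x :: B ++ y :: C)) => //.
move=> [|[|[|//]]] _.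
- apply: (@color_edge_at (A ++ x :: B ++ y :: C) [::] (A ++ [:: x]) (B ++ y :: C));
    try by [counting | sizing | recolor eA].
  by rewrite /= -?catA.
- apply: (@color_edge_at (A ++ x :: B ++ y :: C) A (x :: B ++ [:: y]) C);
    try by [counting | sizing | recolor eB].
  by rewrite /= -?catA.
- apply: (@color_edge_at (A ++ x :: B ++ y :: C) (A ++ x :: B) (y :: C) [::]);
    try by [counting | sizing | recolor eC].
  by rewrite /= -?catA ?cats0.
Qed.

Lemma path4_copy : path4 r c b -> contains_copy (loose_path r.+2 4) F.
Proof.
move=> [x [y [z [A [B [C [D [uni [[sA sB sC sD] [eA eB eC eD]]]]]]]]]].
have us : uniq (A ++ x :: B ++ y :: C ++ z :: D) by counting.
have sz : size (A ++ x :: B ++ y :: C ++ z :: D) = (4 * r.+1).+1 by sizing.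
apply: (@loose_path_copy F _ _ (A ++ x :: B ++ y :: C ++ z :: D)) => //.
move=> [|[|[|[|//]]]] _.
- apply: (@color_edge_at (A ++ x :: B ++ y :: C ++ z :: D)
    [::] (A ++ [:: x]) (B ++ y :: C ++ z :: D));
    try by [counting | sizing | recolor eA].
  by rewrite /= -?catA.
- apply: (@color_edge_at (A ++ x :: B ++ y :: C ++ z :: D)
    A (x :: B ++ [:: y]) (C ++ z :: D));
    try by [counting | sizing | recolor eB].
  by rewrite /= -?catA.
- apply: (@color_edge_at (A ++ x :: B ++ y :: C ++ z :: D)
    (A ++ x :: B) (y :: C ++ [:: z]) D);
    try by [counting | sizing | recolor eC].
  by rewrite /= -?catA /= -?catA.
- apply: (@color_edge_at (A ++ x :: B ++ y :: C ++ z :: D)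
    (A ++ x :: B ++ y :: C) (z :: D) [::]);
    try by [counting | sizing | recolor eD].
  by rewrite /= -?catA /= -?catA ?cats0.
Qed.

Lemma star3_copy : star3 r c b -> contains_copy (star r.+2 3) F.
Proof.
move=> [x [A [B [C [uni [[sA sB sC] [eA eB eC]]]]]]].
have us : uniq (A ++ B ++ C) by counting.
have sz : size (A ++ B ++ C) = 3 * r.+1 by sizing.
apply: (@star_copy F _ _ x (A ++ B ++ C)) => //.
move=> [|[|[|//]]] _ /=.
- rewrite drop0 take_size_cat //.
  by apply: color_edge; by [counting | sizing | recolor eA].
- rewrite mul1n drop_size_cat // take_size_cat //.
  by apply: color_edge; by [counting | sizing | recolor eB].
- rewrite catA drop_size_cat; last by sizing.
  rewrite take_oversize; last by rewrite sC.
  by apply: color_edge; by [counting | sizing | recolor eC].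
Qed.

End ColorCopies.

Lemma contains_copy_color k N (c : {set 'I_N} -> bool) b G :
  contains_copy G (@Hypergraph 'I_N [set e : {set 'I_N} | (#|e| == k) && (c e == b)]) ->
  contains_copy G (color_class k c b).
Proof. by move=> [f fi fe]; exists f => // e /fe; rewrite !inE. Qed.

(** * Multiple copies *)

Lemma set_between (T : finType) (A B : {set T}) s : A \subset B ->
  #|A| <= s <= #|B| -> exists X : {set T}, [/\ A \subset X, X \subset B & #|X| = s].
Proof.
move=> AB /andP[As sB]; elim: s As sB => [|s IH].
  by rewrite leqn0 => A0 _; exists A; split => //; apply/eqP.
rewrite leq_eqVlt => /orP[/eqP e sB | As sB]; first by exists A.
have [X [AX XB sX]] := IH As (ltnW sB).
have /properP[_ [x xB xX]] : X \proper B by rewrite properEcard XB sX.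
exists (x |: X); split.
- exact: subset_trans AX (subsetUr _ _).
- by rewrite subUset sub1set xB.
- by rewrite cardsU1 xX sX.
Qed.

Ltac card_lia :=
  rewrite ?mulSn ?mulnS;
  repeat match goal with
  | |- context [@card.body (vertices ?G) ?s] =>
      let n := fresh "n" in pose (n := @card.body (vertices G) s);
      repeat (progress change (@card.body (vertices G) _) with n); clearbody n
  end;
  repeat match goal with
  | |- context [@card.body ?U ?s] => generalize (@card.body U s); intro
  end;
  repeat match goal with
  | |- context [?a * ?b] => generalize (a * b); intro
  end;
  lia.

Section Multiple.

Variables (k : nat) (T : finType) (c : {set T} -> bool).
Implicit Types (G H : hypergraph) (W X Y Z : {set T}) (b : bool).
Local Notation F b := (@Hypergraph T [set e : {set T} | (#|e| == k) && (c e == b)]).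

Definition copy_in b G W := exists f : G -> T,
  [/\ injective f, forall v, f v \in W
    & forall e, e \in edges G -> f @: e \in edges (F b)].

(** Disjoint copies in a form suited to removing one at a time; [copies_in_copies] assembles them
    into a single embedding. *)
Fixpoint copies_in b G n W := if n is n'.+1 then
    exists f : G -> T, [/\ injective f, forall v, f v \in W,
      forall e, e \in edges G -> f @: e \in edges (F b)
    & copies_in b G n' (W :\: f @: setT)]
  else True.

Lemma copy_in_sub b G W X : W \subset X -> copy_in b G W -> copy_in b G X.
Proof.
by move=> /subsetP WX [f [fi fW fe]]; exists f; split => // v; apply/WX/fW.
Qed.

Lemma copies_in_sub b G n W X :
  W \subset X -> copies_in b G n W -> copies_in b G n X.
Proof.
elim: n W X => //= n IH W X WX [f [fi fW fe fn]]; exists f; split => //.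
  by move=> v; apply: (subsetP WX).
by apply: IH fn; apply: setSD.
Qed.

Lemma copies_in_copies b G n W : copies_in b G n W ->
  contains_copy (copies n G) (F b).
Proof.
move=> h; suff [f [fi _ fe]] : exists f : 'I_n * G -> T,
    [/\ injective f, forall p, f p \in W
      & forall i e, e \in edges G -> [set f (i, x) | x in e] \in edges (F b)].
  exists f => // _ /imset2P[i e _ eG ->].
  by rewrite -imset_comp; apply: fe.
elim: n W h => [|n IH] W /=.
  have no_ord (p : 'I_0 * G) : False by case: p => [[]].
  by move=> _; exists (fun p => False_rect _ (no_ord p));
    split=> [p | p | []//]; case: (no_ord p).
move=> [f [fi fW fe /IH[f' [f'i f'W f'e]]]].
pose g (p : 'I_n.+1 * G) := if unlift ord0 p.1 is Some i then f' (i, p.2) else f p.2.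
have sep p x : f' p != f x.
  have := f'W p; rewrite inE => /andP[nf _]; apply: contraNneq nf => ->.
  by apply: imset_f.
exists g; split.
- move=> [i x] [j y]; rewrite /g /=.
  case: unliftP => [i'|] ->; case: unliftP => [j'|] -> e.
  + by case: (f'i _ _ e) => -> ->.
  + by case/eqP: (sep (i', x) y).
  + by case/eqP: (sep (j', y) x).
  + by rewrite (fi _ _ e).
- move=> [i x]; rewrite /g /=; case: unliftP => [i'|] _; last exact: fW.
  by have := f'W (i', x); rewrite inE => /andP[].
- move=> i e eG; rewrite /g /=.
  by case: unliftP => [i'|] _; [apply: f'e | apply: fe].
Qed.

Lemma arrows_in M G H W : arrows k M G H -> M <= #|W| ->
  copy_in true G W \/ copy_in false H W.
Proof.
move=> ar leM; pose g (i : 'I_M) : T := enum_val (widen_ord leM i).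
have gi : injective g.
  by move=> i j /enum_val_inj/(congr1 val)/= e; apply: val_inj.
have transfer b K : contains_copy K (color_class k (fun e => c (g @: e)) b) ->
    copy_in b K W.
  move=> [f fi fe]; exists (g \o f); split; first exact: inj_comp.
    by move=> v; apply: enum_valP.
  by move=> e /fe; rewrite !inE (imset_comp g f) (card_imset _ gi).
have [h | h] := ar (fun e => c (g @: e)).
  by left; apply: transfer h.
by right; apply: transfer h.
Qed.

Lemma card_image_copy G (f : G -> T) W : injective f ->
  #|W| - #|G| <= #|W :\: f @: setT|.
Proof.
move=> fi; rewrite cardsD leq_sub2l // -[#|G|]cardsT -(card_imset _ fi).
exact: subset_leq_card (subsetIr _ _).
Qed.

(** When the last copy is chosen, [n - 1] copies have been removed and at least [s] vertices remain;
    the bound states this without subtraction. *)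
Lemma greedy_copies b G s n W :
  (forall X, X \subset W -> s <= #|X| -> copy_in b G X) ->
  n * #|G| + s <= #|W| + #|G| -> copies_in b G n W.
Proof.
elim: n W => //= n IH W hs le.
have [||f [fi fW fe]] := hs W; [by [] | by move: le; card_lia |].
exists f; split => //; apply: IH => [X XW sX|].
  by apply: hs => //; apply: subset_trans XW (subsetDl _ _).
by move: le (card_image_copy W fi); card_lia.
Qed.

(* Walking from a set containing a copy of [G] to one containing a copy of [H],
   one vertex at a time, at some step both copies fit in one extra vertex. *)
Lemma overlapping_copies G H s W X Y : arrows k s G H ->
    X \subset W -> Y \subset W -> #|X| = s -> #|Y| = s ->
    copy_in true G X -> copy_in false H Y ->
  exists Z, [/\ Z \subset W, #|Z| <= s.+1, copy_in true G Z & copy_in false H Z].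
Proof.
move=> ar; have [n] := ubnP #|Y :\: X|; elim: n X => // n IH X le XW YW sX sY cX cY.
have [YX | /subsetPn[y yY yX]] := boolP (Y \subset X).
  exists X; split => //; first by rewrite sX.
  exact: copy_in_sub cY.
have [XY | /subsetPn[x xX xY]] := boolP (X \subset Y).
  exists Y; split => //; first by rewrite sY.
  exact: copy_in_sub cX.
have sX' : #|y |: (X :\ x)| = s.
  by rewrite cardsU1 !inE (negPf yX) andbF (cardsD1 x X) xX in sX *.
have X'W : y |: (X :\ x) \subset W.
  rewrite subUset sub1set (subsetP YW) //=.
  exact: subset_trans (subsetDl _ _) XW.
have [cX' | cX'] := arrows_in ar (eq_leq (esym sX')).
  apply: (IH (y |: (X :\ x))) => //.
  rewrite -ltnS; apply: leq_trans le; rewrite ltnS.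
  apply: proper_card; apply/properP; split.
    apply/subsetP => z; rewrite !inE negb_or negb_and negbK.
    by case/andP=> /andP[_ /orP[/eqP-> | ->]] zY; rewrite ?zY // (negPf xY) in zY *.
  by exists y; rewrite !inE ?yX ?yY ?eqxx.
exists (y |: X); split.
- by rewrite subUset sub1set (subsetP YW) // XW.
- by rewrite cardsU1 yX sX.
- by apply: copy_in_sub cX; apply: subsetUr.
- by apply: copy_in_sub cX'; apply: setUS; apply: subsetDl.
Qed.

Lemma copies_in_overlap b G n W X : X \subset W -> copy_in b G X ->
  copies_in b G n (W :\: X) -> copies_in b G n.+1 W.
Proof.
move=> XW [f [fi fX fe]] h; exists f; split => //.
  by move=> v; apply: (subsetP XW).
apply: copies_in_sub h; apply: setDS.
by apply/subsetP => _ /imsetP[v _ ->].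
Qed.

(** If one colour has no copy at all, the other is packed greedily. As long as there are more red
    copies to find than blue ones, a red copy is removed. Once the numbers are equal, a set of at
    most [#|G| + t] vertices containing both copies is removed, which is what the bound loses when
    both numbers drop by one. *)
Lemma multiple_copies G H t m n W : arrows k (#|G| + t - 1) G H ->
    0 < t -> #|H| <= #|G| -> n <= m -> m * #|G| + t * n - 1 <= #|W| ->
  copies_in true G m W \/ copies_in false H n W.
Proof.
move=> ar t_gt0 HG; elim: m n W => [|m IH] n W nm leW; first by left.
case: n nm leW => [|n] nm leW; first by right.
have nmG : n * #|H| <= m * #|G| by apply: leq_mul.
have [cG | nG] := classic (copy_in true G W); last first.
  right; apply: (@greedy_copies _ _ (#|G| + t - 1)).
    move=> X XW sX; have [cG | //] := arrows_in ar sX.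
    by case: nG; apply: copy_in_sub cG.
  by move: leW nmG; card_lia.
have [lt_nm | ge_nm] := ltnP n m.
  case: cG => [f [fi fW fe]].
  have [||hG | hH] := IH n.+1 (W :\: f @: setT); [by [] | | |].
  - by move: leW (card_image_copy W fi); card_lia.
  - by left; exists f.
  - by right; apply: copies_in_sub hH; apply: subsetDl.
have {ge_nm} nm' : n = m by apply/eqP; rewrite eqn_leq ge_nm andbT -ltnS.
have [cH | nH] := classic (copy_in false H W); last first.
  left; apply: (@greedy_copies _ _ (#|G| + t - 1)).
    move=> X XW sX; have [// | cH] := arrows_in ar sX.
    by case: nH; apply: copy_in_sub cH.
  by move: leW; card_lia.
have extend b (K : hypergraph) : #|K| <= #|G| -> copy_in b K W ->
    exists X, [/\ X \subset W, #|X| = #|G| + t - 1 & copy_in b K X].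
  move=> KG [f [fi fW fe]].
  have fsW : f @: setT \subset W by apply/subsetP => _ /imsetP[v _ ->].
  have sf : #|f @: setT| = #|K| by rewrite card_imset // cardsT.
  have [|X [fX XW sX]] := @set_between _ (f @: setT) W (#|G| + t - 1) fsW.
    by rewrite sf; move: leW KG; card_lia.
  exists X; split => //; exists f; split => // v.
  by apply: (subsetP fX); apply: imset_f.
have [X [XW sX cX]] := extend true G (leqnn _) cG.
have [Y [YW sY cY]] := extend false H HG cH.
have [Z [ZW sZ cGZ cHZ]] := overlapping_copies ar XW YW sX sY cX cY.
have [||hG | hH] := IH n (W :\: Z); [by rewrite nm' | | |].
- by move: leW sZ; rewrite cardsD (setIidPr ZW); card_lia.
- by left; apply: copies_in_overlap ZW cGZ hG.
- by right; apply: copies_in_overlap ZW cHZ hH.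
Qed.

End Multiple.

Lemma arrows_copies k (G H : hypergraph) t m n : arrows k (#|G| + t - 1) G H ->
  0 < t -> #|H| <= #|G| -> n <= m ->
  arrows k (m * #|G| + t * n - 1) (copies m G) (copies n H).
Proof.
move=> ar t_gt0 HG nm c.
have [|h | h] := @multiple_copies k _ c G H t m n setT ar t_gt0 HG nm.
- by rewrite cardsT card_ord.
- by left; apply: contains_copy_color; apply: copies_in_copies h.
- by right; apply: contains_copy_color; apply: copies_in_copies h.
Qed.

(** * Lower bounds *)

Lemma card_interval N (X : {set 'I_N}) a n :
  (forall v : 'I_N, v \in X -> a <= v < a + n) -> #|X| <= n.
Proof.
move=> h; pose g (v : 'I_N) : 'I_n.+1 := inord (v - a).
have gE (v : 'I_N) : v \in X -> g v = v - a :> nat.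
  by move=> /h lt; rewrite inordK //; lia.
have gi : {in X &, injective g}.
  move=> u v uX vX /(congr1 val); rewrite /= !gE // => e; apply: val_inj => /=.
  by move: (h u uX) (h v vX) e; lia.
have card_n : #|[set~ (ord_max : 'I_n.+1)]| = n by rewrite cardsC1 card_ord.
rewrite -(card_in_imset gi) -[leqRHS]card_n.
apply: subset_leq_card; apply/subsetP => _ /imsetP[v vX ->].
rewrite !inE; apply/eqP => /(congr1 val); rewrite /= gE //.
by move: (h v vX); lia.
Qed.

(* The colouring whose red edges are those inside the first [m |G| - 1]
   vertices: every blue copy of [H] has at least [t] of the remaining vertices. *)
Lemma not_arrows_copies k (G H : hypergraph) t m n N :
    0 < m * #|G| -> 0 < t * n ->
    (1 < t * n -> no_isolated_vertex G) ->
    (forall X : {set H}, #|X| < t -> exists2 e, e \in edges H & [disjoint e & X]) ->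
    arrows k N (copies m G) (copies n H) ->
  m * #|G| + t * n - 1 <= N.
Proof.
move=> G_gt0 tn_gt0 iso cover ar; rewrite leqNgt; apply/negP => ltN.
pose a := m * #|G| - 1.
pose Z := [set v : 'I_N | a <= v].
have cardG : #|[set: copies m G]| = m * #|G| by rewrite cardsT card_prod card_ord.
have [[f fi fe] | [f fi fe]] := ar (fun e => [disjoint e & Z]).
  (* If [t * n] is 1, there are fewer than [m * #|G|] vertices and a red copy does not fit.
     Otherwise every vertex of the red copy lies in a red edge, hence among the first [a]
     vertices. *)
  have [tn1 | tn2] := leqP (t * n) 1.
    have : #|f @: setT| <= #|'I_N| by apply: max_card.
    by rewrite card_imset // cardG card_ord; lia.
  have : #|f @: setT| <= a.
    apply: (@card_interval _ _ 0) => _ /imsetP[[i x] _ ->] /=; rewrite add0n.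
    have [e eG xe] := iso tn2 x.
    have := fe [set (i, y) | y in e]; rewrite inE => /(_ _)/andP[].
      by apply/imset2P; exists i e.
    move=> _ /eqP dis; have fx : f (i, x) \in f @: [set (i, y) | y in e].
      by apply: imset_f; apply: imset_f.
    by have := disjointFr dis fx; rewrite inE => /negbT; rewrite -ltnNge.
  by rewrite card_imset // cardG /a; lia.
have cardZ : #|Z| <= t * n - 1.
  apply: (@card_interval _ _ a) => v; rewrite inE => ->.
  by have := ltn_ord v; rewrite /a; lia.
pose X (i : 'I_n) := [set x : H | f (i, x) \in Z].
have cardX i : t <= #|X i|.
  rewrite leqNgt; apply/negP => /cover[e eH dis].
  have := fe [set (i, y) | y in e]; rewrite inE => /(_ _)/andP[].
    by apply/imset2P; exists i e.
  move=> _ /eqP/negbT/pred0Pn[_ /andP[/imsetP[_ /imsetP[x xe ->] ->] fZ]].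
  have xX : x \in X i by rewrite inE; exact: fZ.
  by have := disjointFr dis xe; rewrite xX.
pose P := [set p : copies n H | f p \in Z].
have cardP : #|P| = \sum_(i < n) #|X i|.
  rewrite -sum1_card.
  rewrite [RHS](eq_bigr (fun i => \sum_(x in X i) 1)); last first.
    by move=> i _; rewrite sum1_card.
  rewrite pair_big_dep /=; apply: eq_bigl => -[i x] /=; by rewrite !inE.
have : #|f @: P| <= #|Z|.
  by apply: subset_leq_card; apply/subsetP => _ /imsetP[p pP ->]; rewrite inE in pP.
rewrite card_imset // cardP => le.
have : \sum_(i < n) t <= \sum_(i < n) #|X i| by apply: leq_sum => i _.
rewrite sum_nat_const card_ord; lia.
Qed.

(** * The case of one copy *)

Lemma ramsey_copies k (G H : hypergraph) t m n :
    0 < n -> n <= m -> 0 < t -> 0 < #|G| -> #|H| <= #|G| ->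
    no_isolated_vertex G ->
    (forall X : {set H}, #|X| < t -> exists2 e, e \in edges H & [disjoint e & X]) ->
    arrows k (#|G| + t - 1) G H ->
  is_ramsey_number k (copies m G) (copies n H) (m * #|G| + t * n - 1).
Proof.
move=> n_gt0 nm t_gt0 G_gt0 HG iso cover ar.
have mG_gt0 : 0 < m * #|G| by rewrite muln_gt0 G_gt0 (leq_trans n_gt0 nm).
have tn_gt0 : 0 < t * n by rewrite muln_gt0 t_gt0.
split.
- by rewrite subn_gt0; move: mG_gt0 tn_gt0; card_lia.
- exact: arrows_copies.
- by move=> M _; apply: not_arrows_copies.
Qed.

(** The vertex cover number is at least 2: a set of fewer than two vertices is empty or a singleton.
    Nonemptiness of [H] yields an edge for the empty set. *)
Lemma disjoint_edge (H : hypergraph) : 0 < #|H| ->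
    (forall v : H, exists2 e, e \in edges H & v \notin e) ->
  forall X : {set H}, #|X| < 2 -> exists2 e, e \in edges H & [disjoint e & X].
Proof.
move=> /card_gt0P[v0 _] avoid X; rewrite ltnS => /card_le1_eqP X1.
have [-> | [v vX]] := set_0Vmem X.
  by have [e eH _] := avoid v0; exists e; rewrite // -setI_eq0 setI0.
have [e eH ve] := avoid v; exists e; rewrite // disjoint_sym.
have -> : X = [set v].
  by apply/setP => w; rewrite inE; apply/idP/eqP => [wX | -> //]; apply: X1.
by rewrite disjoints1.
Qed.

(** * Isolated vertices and vertex covers of cycles, paths and stars *)

Section Shapes.

Variable r : nat.
Local Notation k := r.+2.

Lemma loose_cycle_no_isolated n : no_isolated_vertex (loose_cycle k n).
Proof.
move=> v; have lt := ltn_ord v; have q_lt : v %/ r.+1 < n by rewrite ltn_divLR.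
exists [set v : 'I_(n * k.-1) |
   [exists j : 'I_k, v == (j + Ordinal q_lt * k.-1) %% (n * k.-1) :> nat]].
  exact: imset_f.
rewrite inE; apply/existsP.
have j_lt : v %% r.+1 < k by rewrite ltnW // ltnS ltn_mod.
by exists (Ordinal j_lt); rewrite /= addnC -divn_eq modn_small.
Qed.

Lemma loose_path_no_isolated n : 0 < n -> no_isolated_vertex (loose_path k n).
Proof.
move=> n_gt0 v; have : v <= n * r.+1 by rewrite -ltnS ltn_ord.
(* The last vertex has quotient [n] by [r.+1], which is no edge index; it is the last vertex of edge
   [n.-1]. *)
rewrite leq_eqVlt => /orP[/eqP ev | lt].
  have i_lt : n.-1 < n by rewrite prednK.
  exists [set v : 'I_(n * k.-1).+1 |
    [exists j : 'I_k, v == j + Ordinal i_lt * k.-1 :> nat]].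
    exact: imset_f.
  rewrite inE; apply/existsP; exists ord_max; rewrite /= ev.
  by rewrite -mulSn prednK.
have q_lt : v %/ r.+1 < n by rewrite ltn_divLR.
exists [set v : 'I_(n * k.-1).+1 |
  [exists j : 'I_k, v == j + Ordinal q_lt * k.-1 :> nat]].
  exact: imset_f.
rewrite inE; apply/existsP.
have j_lt : v %% r.+1 < k by rewrite ltnW // ltnS ltn_mod.
by exists (Ordinal j_lt); rewrite /= addnC -divn_eq.
Qed.

Lemma star_no_isolated n : 0 < n -> no_isolated_vertex (star k n).
Proof.
move=> n_gt0 [v | ].
  have q_lt : v %/ r.+1 < n by rewrite ltn_divLR.
  exists (None |: [set Some v | v in [set v : 'I_(n * k.-1) |
      [exists j : 'I_k.-1, v == j + Ordinal q_lt * k.-1 :> nat]]]).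
    exact: imset_f.
  rewrite !inE /=; apply: imset_f; rewrite inE; apply/existsP.
  have j_lt : v %% r.+1 < k.-1 by rewrite ltn_mod.
  by exists (Ordinal j_lt); rewrite /= addnC -divn_eq.
exists (None |: [set Some v | v in [set v : 'I_(n * k.-1) |
    [exists j : 'I_k.-1, v == j + Ordinal n_gt0 * k.-1 :> nat]]]).
  exact: imset_f.
by rewrite !inE.
Qed.

Lemma loose_path_avoid n : 2 < n -> forall v : loose_path k n,
  exists2 e, e \in edges (loose_path k n) & v \notin e.
Proof.
move=> n3 [v v_lt]; have n1 : 0 < n by apply: leq_trans n3.
(* Edge 2 starts at [2 * r.+1], and edge 0 ends before it, at [r.+1]. *)
pose i := if v < 2 * r.+1 then Ordinal n3 else Ordinal n1.
exists [set v : 'I_(n * k.-1).+1 | [exists j : 'I_k, v == j + i * k.-1 :> nat]].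
  exact: imset_f.
rewrite inE; apply/existsP => -[[j jk] /eqP] /=.
by rewrite /i; case: (ltnP v (2 * r.+1)) => /=; lia.
Qed.

Lemma loose_cycle_avoid n : 2 < n -> forall v : loose_cycle k n,
  exists2 e, e \in edges (loose_cycle k n) & v \notin e.
Proof.
move=> n3 [v v_lt]; have n1 : 0 < n by apply: leq_trans n3.
have n2 : 1 < n by apply: leq_trans n3.
have le3 : 3 * r.+1 <= n * r.+1 by rewrite leq_mul2r n3 orbT.
(* Edge 0 ends at [r.+1], where edge 1 starts; edge 2 starts at [2 * r.+1] and, when [n] is 3,
   returns to vertex 0. *)
pose i := if v < r.+1 then Ordinal n2 else
  if v < 2 * r.+1 then Ordinal n3 else Ordinal n1.
exists [set v : 'I_(n * k.-1) |
   [exists j : 'I_k, v == (j + i * k.-1) %% (n * k.-1) :> nat]].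
  exact: imset_f.
rewrite inE; apply/existsP => -[[j jk] /eqP] /=.
rewrite /i; case: (ltnP v r.+1) => [lt | ge] /=.
  by rewrite modn_small; lia.
case: (ltnP v (2 * r.+1)) => [lt | ge'] /=; last by rewrite modn_small; lia.
have [lt3 | ge3] := ltnP (j + 2 * r.+1) (n * r.+1); first by rewrite modn_small; lia.
have -> : j + 2 * r.+1 = n * r.+1 by lia.
by rewrite modnn; lia.
Qed.

End Shapes.

Section BaseCases.

Variable r : nat.
Hypothesis r_gt0 : 0 < r.
Local Notation k := r.+2.

Lemma cycle4_ord N (c : {set 'I_N} -> bool) : 4 * r + 5 <= N -> exists b, cycle4 r c b.
Proof.
move=> le; have sN : size (enum 'I_N) = N by rewrite size_enum_ord.
have [|V [W [defV sV _]]] := @split_at _ (4 * r + 5) (enum 'I_N); first by rewrite sN.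
apply: (@cycle4_exists _ _ _ V) => //.
by have := enum_uniq 'I_N; rewrite defV cat_uniq => /and3P[].
Qed.

Lemma arrows_cycle3_cycle3 :
  arrows k (3 * r + 4) (loose_cycle k 3) (loose_cycle k 3).
Proof.
move=> c; have [|b cb] := @cycle3_exists _ _ c r_gt0; first by rewrite card_ord.
by case: b cb => cb; [left | right]; apply: contains_copy_color; apply: cycle3_copy.
Qed.

Lemma arrows_cycle4_cycle4 :
  arrows k (4 * r + 5) (loose_cycle k 4) (loose_cycle k 4).
Proof.
move=> c; have [//|b cb] := @cycle4_ord _ c.
by case: b cb => cb; [left | right]; apply: contains_copy_color; apply: cycle4_copy.
Qed.

Lemma arrows_cycle4_cycle3 :
  arrows k (4 * r + 5) (loose_cycle k 4) (loose_cycle k 3).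
Proof.
move=> c; have [//|b cb] := @cycle4_ord _ c.
have [ct | cf] : cycle4 r c true \/ cycle3 r c false.
  case: b cb => cb; first by left.
  by apply: (cycle4_cycle3 r_gt0) cb; rewrite card_ord.
- by left; apply: contains_copy_color; apply: cycle4_copy.
- by right; apply: contains_copy_color; apply: cycle3_copy.
Qed.

Lemma arrows_path3_cycle3 :
  arrows k (3 * r + 5) (loose_path k 3) (loose_cycle k 3).
Proof.
move=> c; have [|b cb] := @cycle3_exists _ _ c r_gt0; first by rewrite card_ord; lia.
have [ct | cf] : path3 r c true \/ cycle3 r c false.
  case: b cb => cb; last by right.
  by have [|| []] := cycle3_path3 r_gt0 _ cb; [rewrite card_ord | left | right].
- by left; apply: contains_copy_color; apply: path3_copy.
- by right; apply: contains_copy_color; apply: cycle3_copy.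
Qed.

Lemma arrows_path3_path3 :
  arrows k (3 * r + 5) (loose_path k 3) (loose_path k 3).
Proof.
move=> c; have [|b cb] := @cycle3_exists _ _ c r_gt0; first by rewrite card_ord; lia.
have [b' cb'] : exists b', path3 r c b'.
  have [|h | [_ h]] := cycle3_path3 r_gt0 _ cb; first by rewrite card_ord.
    by exists b.
  by exists (~~ b).
by case: b' cb' => h; [left | right]; apply: contains_copy_color; apply: path3_copy.
Qed.

Lemma arrows_path4_cycle4 :
  arrows k (4 * r + 6) (loose_path k 4) (loose_cycle k 4).
Proof.
move=> c; have [|b cb] := @cycle4_ord _ c; first by lia.
have [ct | cf] : path4 r c true \/ cycle4 r c false.
  case: b cb => cb; last by right.
  by have [|| []] := cycle4_path4 r_gt0 _ cb; [rewrite card_ord | left | right].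
- by left; apply: contains_copy_color; apply: path4_copy.
- by right; apply: contains_copy_color; apply: cycle4_copy.
Qed.

(** There is a red quadrangle or a blue triangle; rerouting a red quadrangle gives a red path or
    again a blue triangle. *)
Lemma arrows_path4_cycle3 :
  arrows k (4 * r + 6) (loose_path k 4) (loose_cycle k 3).
Proof.
move=> c; have [|b cb] := @cycle4_ord _ c; first by lia.
have [ct | cf] : cycle4 r c true \/ cycle3 r c false.
  case: b cb => cb; first by left.
  by apply: (cycle4_cycle3 r_gt0) cb; rewrite card_ord; lia.
- have [|h | [_ h _]] := cycle4_path4 r_gt0 _ ct; first by rewrite card_ord.
    by left; apply: contains_copy_color; apply: path4_copy.
  by right; apply: contains_copy_color; apply: cycle3_copy.
- by right; apply: contains_copy_color; apply: cycle3_copy.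
Qed.

Lemma arrows_path4_path3 :
  arrows k (4 * r + 6) (loose_path k 4) (loose_path k 3).
Proof.
move=> c; have [|b cb] := @cycle4_ord _ c; first by lia.
have [ct | cf] : path4 r c true \/ path3 r c false.
  case: b cb => cb; last by right; apply: cycle4_contains_path3.
  have [|h | [h _ _]] := cycle4_path4 r_gt0 _ cb; first by rewrite card_ord.
    by left.
  by right; apply: cycle4_contains_path3.
- by left; apply: contains_copy_color; apply: path4_copy.
- by right; apply: contains_copy_color; apply: path3_copy.
Qed.

Lemma arrows_path4_path4 :
  arrows k (4 * r + 6) (loose_path k 4) (loose_path k 4).
Proof.
move=> c; have [|b cb] := @cycle4_ord _ c; first by lia.
have [b' cb'] : exists b', path4 r c b'.
  have [|h | [_ _ h]] := cycle4_path4 r_gt0 _ cb; first by rewrite card_ord.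
    by exists b.
  by exists (~~ b).
by case: b' cb' => h; [left | right]; apply: contains_copy_color; apply: path4_copy.
Qed.

Lemma arrows_star3_star3 : arrows k (3 * r + 4) (star k 3) (star k 3).
Proof.
move=> c; have [|b cb] := @star3_exists _ _ c r_gt0; first by rewrite card_ord.
by case: b cb => cb; [left | right]; apply: contains_copy_color; apply: star3_copy.
Qed.

End BaseCases.

(** * Copies against disjoint edges *)

Lemma arrows_edge k (H : hypergraph) : uniform k H ->
  arrows k #|H| H (complete k k).
Proof.
move=> uH c.
have [[e [ek ce]] | ne] := classic (exists e : {set 'I_#|H|}, #|e| = k /\ c e = false).
  right; pose f (i : 'I_k) := enum_val (cast_ord (esym ek) i).
  have fi : injective f by move=> i j /enum_val_inj/cast_ord_inj.
  exists f => // d; rewrite !inE => /eqP dk.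
  suff -> : f @: d = e by rewrite ek ce eqxx.
  apply/eqP; rewrite eqEcard card_imset // ek dk leqnn andbT.
  by apply/subsetP => _ /imsetP[i _ ->]; apply: enum_valP.
left; exists enum_rank; first exact: enum_rank_inj.
move=> e eH; rewrite !inE card_imset ?uH ?eqxx //=; last exact: enum_rank_inj.
apply/eqP; apply: contraT => /negbTE ce; case: ne; exists (enum_rank @: e).
by rewrite ce card_imset ?uH //; apply: enum_rank_inj.
Qed.

Lemma ramsey_copies_edge k (H : hypergraph) m n :
    0 < n -> n <= m -> uniform k H -> 0 < #|H| ->
    (1 < n -> no_isolated_vertex H) ->
  is_ramsey_number k (copies m H) (copies n (complete k k)) (m * #|H| + n - 1).
Proof.
move=> n_gt0 nm uH H_gt0 iso.
have mH_gt0 : 0 < m * #|H| by rewrite muln_gt0 H_gt0 (leq_trans n_gt0 nm).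
split.
- by rewrite subn_gt0; move: mH_gt0 n_gt0; card_lia.
- have [kH | Hk] := leqP k #|H|.
    rewrite -[n in X in _ + X]mul1n; apply: arrows_copies => //.
      by rewrite addnK; apply: arrows_edge.
    by rewrite card_ord.
  (* With fewer than [k] vertices [H] has no edges, so its vertices are isolated and [iso] leaves
     only [n = 1]; any injection is then a red copy. *)
  have noE : edges H = set0.
    apply/setP => e; rewrite inE; apply/negP => /uH ek.
    by move: Hk; rewrite -ek ltnNge max_card.
  have n1 : n = 1.
    apply/eqP; rewrite eqn_leq n_gt0 andbT leqNgt; apply/negP => /iso noiso.
    by have /card_gt0P[v _] := H_gt0; have [e] := noiso v; rewrite noE inE.
  move=> c; left.
  have le : #|copies m H| <= m * #|H| + n - 1.
    by rewrite card_prod card_ord n1 addnK.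
  exists (fun p => widen_ord le (enum_rank p)).
    by move=> p q /(congr1 val)/= /val_inj/enum_rank_inj.
  by move=> d /imset2P[i e _ me _]; move: me; rewrite noE inE.
- move=> M _ ar; rewrite -[n in X in X - 1]mul1n.
  apply: not_arrows_copies ar; rewrite ?mul1n //.
  move=> X; rewrite ltnS leqn0 cards_eq0 => /eqP->.
  by exists setT; [rewrite inE cardsT card_ord | rewrite -setI_eq0 setI0].
Qed.

Theorem theorem3p8 (k m n : nat) (hn : 1 <= n) (hmn : n <= m) (hk : 3 <= k) :
  (* (i) *)
  (is_ramsey_number k (copies m (loose_cycle k 3)) (copies n (loose_cycle k 3))
     (m * (3 * k - 3) + 2 * n - 1) /\
   is_ramsey_number k (copies m (loose_cycle k 4)) (copies n (loose_cycle k 3))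
     (m * (4 * k - 4) + 2 * n - 1) /\
   is_ramsey_number k (copies m (loose_cycle k 4)) (copies n (loose_cycle k 4))
     (m * (4 * k - 4) + 2 * n - 1)) /\
  (* (ii) *)
  (is_ramsey_number k (copies m (loose_path k 3)) (copies n (loose_cycle k 3))
     (m * (3 * k - 2) + 2 * n - 1) /\
   is_ramsey_number k (copies m (loose_path k 4)) (copies n (loose_cycle k 3))
     (m * (4 * k - 3) + 2 * n - 1) /\
   is_ramsey_number k (copies m (loose_path k 4)) (copies n (loose_cycle k 4))
     (m * (4 * k - 3) + 2 * n - 1)) /\
  (* (iii) *)
  (is_ramsey_number k (copies m (loose_path k 3)) (copies n (loose_path k 3))
     (m * (3 * k - 2) + 2 * n - 1) /\
   is_ramsey_number k (copies m (loose_path k 4)) (copies n (loose_path k 3))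
     (m * (4 * k - 3) + 2 * n - 1) /\
   is_ramsey_number k (copies m (loose_path k 4)) (copies n (loose_path k 4))
     (m * (4 * k - 3) + 2 * n - 1)) /\
  (* (iv) *)
  is_ramsey_number k (copies m (star k 3)) (copies n (star k 3))
    (m * (3 * k - 2) + n - 1) /\
  (* (v) *)
  ((forall H : hypergraph, uniform k H -> 0 < #|H| ->
      (1 < n -> no_isolated_vertex H) ->
      is_ramsey_number k (copies m H) (copies n (complete k k))
        (m * #|H| + n - 1)) /\
   is_ramsey_number k (copies m (complete k k)) (copies n (complete k k))
     (m * k + n - 1)).
Proof.
case: k hk => [|[|r]] // hk; have r_gt0 : 0 < r by [].
have cycleE p : #|loose_cycle r.+2 p| = p * r.+1 by rewrite card_ord.
have pathE p : #|loose_path r.+2 p| = (p * r.+1).+1 by rewrite card_ord.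
have starE p : #|star r.+2 p| = (p * r.+1).+1 by rewrite card_option card_ord.
have c3 : 3 * r.+2 - 3 = #|loose_cycle r.+2 3| by rewrite cycleE; lia.
have c4 : 4 * r.+2 - 4 = #|loose_cycle r.+2 4| by rewrite cycleE; lia.
have p3 : 3 * r.+2 - 2 = #|loose_path r.+2 3| by rewrite pathE; lia.
have p4 : 4 * r.+2 - 3 = #|loose_path r.+2 4| by rewrite pathE; lia.
have s3 : #|loose_path r.+2 3| = #|star r.+2 3| by rewrite pathE starE.
have cyc_edge p : 2 < p -> forall X : {set loose_cycle r.+2 p}, #|X| < 2 ->
    exists2 e, e \in edges (loose_cycle r.+2 p) & [disjoint e & X].
  move=> p3'; apply: disjoint_edge; last exact: loose_cycle_avoid.
  by rewrite cycleE muln_gt0 andbT; apply: leq_trans p3'.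
have path_edge p : 2 < p -> forall X : {set loose_path r.+2 p}, #|X| < 2 ->
    exists2 e, e \in edges (loose_path r.+2 p) & [disjoint e & X].
  by move=> p3'; apply: disjoint_edge; [rewrite pathE | apply: loose_path_avoid].
have star_edge (X : {set star r.+2 3}) : #|X| < 1 ->
    exists2 e, e \in edges (star r.+2 3) & [disjoint e & X].
  rewrite ltnS leqn0 cards_eq0 => /eqP->.
  have [e eS _] := @star_no_isolated r 3 isT None.
  by exists e; rewrite // -setI_eq0 setI0.
(* No single vertex covers the edges of the cycles and paths involved, hence [t = 2] and base cases
   on [#|G| + 1] vertices. *)
have main (G H : hypergraph) N : 0 < #|G| -> #|H| <= #|G| -> no_isolated_vertex G ->
    (forall X : {set H}, #|X| < 2 -> exists2 e, e \in edges H & [disjoint e & X]) ->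
    N = #|G| + 1 -> arrows r.+2 N G H ->
    is_ramsey_number r.+2 (copies m G) (copies n H) (m * #|G| + 2 * n - 1).
  move=> G_gt0 HG iso cover -> ar; apply: ramsey_copies => //.
  by rewrite -addnBA.
have cyc_iso := loose_cycle_no_isolated.
have path_iso := loose_path_no_isolated.
rewrite c3 c4 p3 p4.
split; [split; [|split] | split; [split; [|split] | split; [split; [|split] | split; [|split]]]].
- by apply: main (arrows_cycle3_cycle3 r_gt0); rewrite ?cycleE //;
    [apply: cyc_edge | lia].
- by apply: main (arrows_cycle4_cycle3 r_gt0); rewrite ?cycleE //;
    [lia | apply: cyc_edge | lia].
- by apply: main (arrows_cycle4_cycle4 r_gt0); rewrite ?cycleE //;
    [apply: cyc_edge | lia].
- apply: main (arrows_path3_cycle3 r_gt0); rewrite ?cycleE ?pathE //;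
    try by [lia | apply: path_iso].
  exact: cyc_edge.
- apply: main (arrows_path4_cycle3 r_gt0); rewrite ?cycleE ?pathE //;
    try by [lia | apply: path_iso].
  exact: cyc_edge.
- apply: main (arrows_path4_cycle4 r_gt0); rewrite ?cycleE ?pathE //;
    try by [lia | apply: path_iso].
  exact: cyc_edge.
- apply: main (arrows_path3_path3 r_gt0); rewrite ?pathE //;
    try by [lia | apply: path_iso].
  exact: path_edge.
- apply: main (arrows_path4_path3 r_gt0); rewrite ?pathE //;
    try by [lia | apply: path_iso].
  exact: path_edge.
- apply: main (arrows_path4_path4 r_gt0); rewrite ?pathE //;
    try by [lia | apply: path_iso].
  exact: path_edge.
(* The centre of a star covers all its edges, so here [t = 1]. *)
- rewrite s3 -[n in X in _ + X]mul1n; apply: ramsey_copies => //.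
  + by rewrite starE.
  + exact: star_no_isolated.
  + rewrite starE; have -> : (3 * r.+1).+1 + 1 - 1 = 3 * r + 4 by lia.
    exact: arrows_star3_star3.
- by move=> H uH H_gt0 iso; apply: ramsey_copies_edge.
- have cE : #|complete r.+2 r.+2| = r.+2 by rewrite card_ord.
  rewrite -[X in m * X]cE; apply: ramsey_copies_edge; rewrite ?cE //.
    by move=> e; rewrite inE => /eqP.
  by move=> _ v; exists setT; rewrite ?inE // cardsT cE.
Qed.
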